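(* In each of the following cases there exists a faithful uniserial $\mathfrak g$-module of length $3$ with socle factors $V(a),V(b),V(a)$: (i) $m=1$ and $b=a+1$ ($a\ge0$), or $m=1$ and $b=a-1$ with $a>0$; (ii) $m\ge3$ and $(a,b)\in\{(0,m),(1,m+1),(1,m-1)\}$, or $m=3$ and $(a,b)=(4,3)$.
   Context: $\mathbb F$ is a field of characteristic zero; all Lie algebras and modules are finite dimensional over $\mathbb F$. For an integer $a\ge0$, $V(a)$ denotes the irreducible $\mathfrak{sl}(2)$-module of highest weight $a$. $\mathfrak h_n$ ($n\ge1$) is the Heisenberg Lie algebra of dimension $2n+1$, with one-dimensional center $\mathfrak z=\mathbb F z$ and $[\mathfrak h_n,\mathfrak h_n]=\mathfrak z$; $m=2n-1$. $\mathfrak{sl}(2)$ acts on $\mathfrak h_n$ by derivations so that $\mathfrak h_n\cong V(m)\oplus\mathfrak z$ as $\mathfrak{sl}(2)$-modules, with $\mathfrak z\cong V(0)$; explicitly, with a basis $v_0,\dots,v_m$ of $V(m)$ satisfying $hv_i=(m-2i)v_i$, $ev_i=(m-i+1)v_{i-1}$, $fv_i=(i+1)v_{i+1}$, one has $[v_i,v_j]=0$ if $i+j\neq m$ and $[v_i,v_{m-i}]=(-1)^i\binom{m}{i}z$. $\mathfrak g=\mathfrak{sl}(2)\ltimes\mathfrak h_n$. A $\mathfrak g$-module is uniserial of length $\ell$ if its socle series $0=\mathrm{soc}^0\subset\cdots\subset\mathrm{soc}^\ell=V$ (where $\mathrm{soc}^i/\mathrm{soc}^{i-1}$ is the socle of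 $V/\mathrm{soc}^{i-1}$) has all factors irreducible; these socle factors are identified with $\mathfrak{sl}(2)$-modules $V(a)$. Faithful means the representation is injective. *)

(* Defs.v *)
From HB Require Import structures.
From mathcomp Require Import all_boot all_order all_algebra.
Set Implicit Arguments. Unset Strict Implicit. Unset Printing Implicit Defensive.
Import Order.TTheory GRing.Theory Num.Theory.
Local Open Scope ring_scope.

(* A (matrix) representation of g = sl(2) |x h_n on F^d, given by the images
   of the basis e, f, h (of sl(2)), v_0..v_m (of V(m)) and z (center of h_n).
   The module action on a row vector v is  v |-> v *m M^T  (i.e. M acting on
   the column vector v^T), so subspaces are row spaces (mxalgebra). *)
Record grep (F : fieldType) (m d : nat) := GRep {
  rE : 'M[F]_d; rF : 'M[F]_d; rH : 'M[F]_d;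
  rX : 'I_m.+1 -> 'M[F]_d; rZ : 'M[F]_d }.

Definition bra (F : fieldType) (d : nat) (A B : 'M[F]_d) : 'M[F]_d :=
  A *m B - B *m A.

Definition rXs (F : fieldType) m d (r : grep F m d) (k : nat) : 'M[F]_d :=
  if (k <= m)%N then rX r (inord k) else 0.

Definition is_g_rep (F : fieldType) m d (r : grep F m d) : Prop :=
  [/\ bra (rH r) (rE r) = 2%:R *: rE r,
      bra (rH r) (rF r) = - (2%:R *: rF r),
      bra (rE r) (rF r) = rH r,
      bra (rE r) (rZ r) = 0 /\ bra (rF r) (rZ r) = 0 /\ bra (rH r) (rZ r) = 0 &
   [/\ forall i : 'I_m.+1,
         bra (rH r) (rX r i) = (m%:R - (2 * i)%:R) *: rX r i,
       forall i : 'I_m.+1,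
         bra (rE r) (rX r i) =
           (if i == 0%N :> nat then 0 else (m - i + 1)%:R *: rXs r i.-1),
       forall i : 'I_m.+1,
         bra (rF r) (rX r i) = (i + 1)%:R *: rXs r i.+1,
       forall i j : 'I_m.+1,
         bra (rX r i) (rX r j) =
           (if (i + j == m)%N then ((-1) ^+ i * ('C(m, i))%:R) *: rZ r else 0) &
       forall i : 'I_m.+1, bra (rX r i) (rZ r) = 0]].

Definition faithful (F : fieldType) m d (r : grep F m d) : Prop :=
  forall (ce cf ch cz : F) (cx : 'I_m.+1 -> F),
    ce *: rE r + cf *: rF r + ch *: rH r + \sum_i cx i *: rX r i + cz *: rZ r = 0 ->
    [/\ ce = 0, cf = 0, ch = 0, cz = 0 & forall i, cx i = 0].

Definition stable (F : fieldType) m d (r : grep F m d) (U : 'M[F]_d) : Prop :=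
  [/\ (U *m (rE r)^T <= U)%MS, (U *m (rF r)^T <= U)%MS, (U *m (rH r)^T <= U)%MS,
      (U *m (rZ r)^T <= U)%MS & forall i, (U *m (rX r i)^T <= U)%MS].

Definition minimal_over (F : fieldType) m d (r : grep F m d) (U W : 'M[F]_d) : Prop :=
  [/\ stable r U, stable r W, (U < W)%MS &
      forall Y : 'M[F]_d, stable r Y -> (U <= Y)%MS -> (Y <= W)%MS ->
        (Y == U)%MS \/ (Y == W)%MS].

Definition is_socle (F : fieldType) m d (r : grep F m d) (U S : 'M[F]_d) : Prop :=
  [/\ stable r S, (U <= S)%MS,
      (forall W, minimal_over r U W -> (W <= S)%MS) &
      exists k (ws : 'I_k -> 'M[F]_d),
        (forall j, minimal_over r U (ws j)) /\ (S == U + \sum_j ws j)%MS].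

Definition factor_is_V (F : fieldType) m d (r : grep F m d) (U W : 'M[F]_d) (a : nat) :
  Prop :=
  exists B : 'M[F]_(a.+1, d),
    let w (k : nat) : 'rV[F]_d := if (k <= a)%N then row (inord k) B else 0 in
    [/\ (W == U + B)%MS,
        \rank (U + B)%MS = (\rank U + a.+1)%N,
        forall i : 'I_a.+1,
          (row i B *m (rH r)^T - (a%:R - (2 * i)%:R) *: row i B <= U)%MS,
        forall i : 'I_a.+1,
          (row i B *m (rE r)^T
             - (if i == 0%N :> nat then 0 else (a - i + 1)%:R *: w i.-1) <= U)%MS &
        forall i : 'I_a.+1,
          (row i B *m (rF r)^T - (i + 1)%:R *: w i.+1 <= U)%MS].

Definition uniserial3 (F : fieldType) m d (r : grep F m d) (a1 a2 a3 : nat) : Prop :=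
  exists S1 S2 : 'M[F]_d,
    [/\ is_socle r 0 S1, is_socle r S1 S2, is_socle r S2 1%:M &
    [/\ minimal_over r 0 S1, minimal_over r S1 S2, minimal_over r S2 1%:M &
    [/\ factor_is_V r 0 S1 a1, factor_is_V r S1 S2 a2 & factor_is_V r S2 1%:M a3]]].

(* Main.v *)
Require Import Defs.
From HB Require Import structures.
From mathcomp Require Import all_boot all_order all_algebra.
From mathcomp Require Import zify ring.
Set Implicit Arguments. Unset Strict Implicit. Unset Printing Implicit Defensive.
Import GRing.Theory.
Local Open Scope ring_scope.

(* Let V = V(a) + V(b) + V(a) as an sl(2)-module, and let v_i act through
   sl(2)-equivariant maps A : V(m) x V(a) -> V(b) from the third block to the
   second and B : V(m) x V(b) -> V(a) from the second to the first.  This is a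
   g-module as soon as B_i A_j - B_j A_i is the scalar g [v_i, v_j] / z, with z
   acting by g from the third block to the first.  If g <> 0, it is faithful and
   uniserial: z carries the third block onto the first, so neither A nor B
   kills a nonzero vector, and the blocks are irreducible over sl(2).

   The maps A and B are transvectants: multiplication of binary forms and its
   adjoint, contraction, when b = a + m, or b = a - 1 and m = 1; contraction of
   the form of degree m by the one of lower degree when (a, b) = (1, m - 1); and
   the second and first transvectants when (m, a, b) = (3, 4, 3). *)

(** * The irreducible sl(2)-modules in the monomial basis *)

Section SL2.
Variable F : fieldType.
Implicit Types (a b i j k : nat).

(** Entries are functions of natural numbers, so that the index shifts caused by [e] and [f] are
    plain [j.+1] and [k.-1], without ordinal casts. *)
Definition nmx p q (f : nat -> nat -> F) : 'M[F]_(p.+1, q.+1) :=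
  \matrix_(j, k) f j k.

Lemma eq_nmx p q (f g : nat -> nat -> F) :
  (forall j k, (j <= p)%N -> (k <= q)%N -> f j k = g j k) ->
  nmx p q f = nmx p q g.
Proof.
by move=> fg; apply/matrixP => j k; rewrite !mxE fg // -ltnS ltn_ord.
Qed.

Lemma nmxB p q f g : nmx p q f - nmx p q g = nmx p q (fun j k => f j k - g j k).
Proof. by apply/matrixP => j k; rewrite !mxE. Qed.

Lemma nmxZ p q c f : c *: nmx p q f = nmx p q (fun j k => c * f j k).
Proof. by apply/matrixP => j k; rewrite !mxE. Qed.

Lemma nmx0 p q : nmx p q (fun _ _ => 0) = 0.
Proof. by apply/matrixP => j k; rewrite !mxE. Qed.

Lemma nmx_scalar p c : nmx p p (fun j k => if j == k then c else 0) = c%:M.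
Proof. by apply/matrixP => j k; rewrite !mxE -val_eqE /=; case: eqP. Qed.

(* The monomials x^(a-k) y^k are the basis of V(a), with e = x d/dy and
   f = y d/dx. *)
Definition slE a := nmx a a (fun j k => if j.+1 == k then k%:R else 0).
Definition slF a := nmx a a (fun j k => if j == k.+1 then (a%:R - k%:R) else 0).
Definition slH a := nmx a a (fun j k => if j == k then a%:R - (2 * k)%:R else 0).

Lemma sum_ord_eq n (x : nat) (g : nat -> F) :
  \sum_(l < n) (if l == x :> nat then g l else 0) = if (x < n)%N then g x else 0.
Proof. by rewrite -big_mkcond big_ord1_eq. Qed.

Lemma mul_slE_nmx a q f :
  slE a *m nmx a q f =
  nmx a q (fun j k => if (j < a)%N then j.+1%:R * f j.+1 k else 0).
Proof.
apply/matrixP => j k; rewrite !mxE.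
rewrite (eq_bigr (fun l : 'I_a.+1 =>
    if l == j.+1 :> nat then j.+1%:R * f j.+1 k else 0)); last first.
  by move=> l _; rewrite !mxE eq_sym; case: eqP => [->|]; rewrite ?mul0r.
by rewrite (sum_ord_eq _ _ (fun=> _)).
Qed.

Lemma mul_slF_nmx a q f :
  slF a *m nmx a q f =
  nmx a q (fun j k => if (0 < j)%N then (a%:R - j.-1%:R) * f j.-1 k else 0).
Proof.
apply/matrixP => j k; rewrite !mxE.
case: j => -[|j] ltj /=.
  by rewrite big1 // => l _; rewrite !mxE mul0r.
rewrite (eq_bigr (fun l : 'I_a.+1 =>
    if l == j :> nat then (a%:R - j%:R) * f j k else 0)); last first.
  move=> l _; rewrite !mxE /= eqSS eq_sym.
  by case: eqP => [->|]; rewrite ?mul0r.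
by rewrite (sum_ord_eq _ _ (fun=> _)) ltnW.
Qed.

Lemma mul_slH_nmx a q f :
  slH a *m nmx a q f = nmx a q (fun j k => (a%:R - (2 * j)%:R) * f j k).
Proof.
apply/matrixP => j k; rewrite !mxE.
rewrite (eq_bigr (fun l : 'I_a.+1 =>
    if l == j :> nat then (a%:R - (2 * j)%:R) * f j k else 0)); last first.
  by move=> l _; rewrite !mxE eq_sym; case: eqP => [->|]; rewrite ?mul0r.
by rewrite (sum_ord_eq _ _ (fun=> _)) ltn_ord.
Qed.

Lemma mul_nmx_slE a q f :
  nmx q a f *m slE a =
  nmx q a (fun j k => if (0 < k)%N then k%:R * f j k.-1 else 0).
Proof.
apply/matrixP => j k; rewrite !mxE.
case: k => -[|k] ltk /=.
  by rewrite big1 // => l _; rewrite !mxE mulr0.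
rewrite (eq_bigr (fun l : 'I_a.+1 =>
    if l == k :> nat then k.+1%:R * f j k else 0)); last first.
  move=> l _; rewrite !mxE /= eqSS.
  by case: eqP => [->|]; rewrite ?mulr0 // mulrC.
by rewrite (sum_ord_eq _ _ (fun=> _)) ltnW.
Qed.

Lemma mul_nmx_slF a q f :
  nmx q a f *m slF a =
  nmx q a (fun j k => if (k < a)%N then (a%:R - k%:R) * f j k.+1 else 0).
Proof.
apply/matrixP => j k; rewrite !mxE.
rewrite (eq_bigr (fun l : 'I_a.+1 =>
    if l == k.+1 :> nat then (a%:R - k%:R) * f j k.+1 else 0)); last first.
  move=> l _; rewrite !mxE.
  by case: eqP => [->|]; rewrite ?mulr0 // mulrC.
by rewrite (sum_ord_eq _ _ (fun=> _)).
Qed.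

Lemma mul_nmx_slH a q f :
  nmx q a f *m slH a = nmx q a (fun j k => (a%:R - (2 * k)%:R) * f j k).
Proof.
apply/matrixP => j k; rewrite !mxE.
rewrite (eq_bigr (fun l : 'I_a.+1 =>
    if l == k :> nat then (a%:R - (2 * k)%:R) * f j k else 0)); last first.
  by move=> l _; rewrite !mxE; case: eqP => [->|]; rewrite ?mulr0 // mulrC.
by rewrite (sum_ord_eq _ _ (fun=> _)) ltn_ord.
Qed.

Lemma bra_slHE a : bra (slH a) (slE a) = 2%:R *: slE a.
Proof.
rewrite /bra /slE mul_slH_nmx mul_nmx_slH nmxB nmxZ.
by apply: eq_nmx => j k _ _; case: eqP => [<-|_]; ring.
Qed.

Lemma bra_slHF a : bra (slH a) (slF a) = - (2%:R *: slF a).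
Proof.
rewrite -scaleNr /bra /slF mul_slH_nmx mul_nmx_slH nmxB nmxZ.
by apply: eq_nmx => j k _ _; case: eqP => [->|_]; ring.
Qed.

Lemma bra_slEF a : bra (slE a) (slF a) = slH a.
Proof.
rewrite /bra {2}/slF mul_slE_nmx mul_nmx_slE nmxB.
apply: eq_nmx => j k leja leka; rewrite eqSS.
have [->|nejk] := eqVneq j k; last first.
  rewrite mulr0 if_same; case: k leka nejk => [|k] _ nejk /=.
    by rewrite subr0.
  by rewrite ifN // mulr0 subr0.
case: (ltngtP k a) leka => // [_|->] _.
  by case: k => [|k] /=; rewrite ?eqxx; ring.
by case: (a) => [|a'] /=; rewrite ?eqxx; ring.
Qed.

(** Equivariance of the map V(m) x V(a) -> V(b) given by the [A i]. V(a) and V(b) carry the monomial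
    basis, but V(m) the basis [v_i = 'C(m, i) x^(m-i) y^i] of the statement; [v_(m+1)] counts as
    0. *)
Definition intertwiner m a b (A : nat -> 'M[F]_(b.+1, a.+1)) := forall i,
  (i <= m)%N ->
  [/\ slH b *m A i - A i *m slH a = (m%:R - (2 * i)%:R) *: A i,
      slE b *m A i - A i *m slE a =
        (if i == 0%N then 0 else (m - i + 1)%:R *: A i.-1) &
      slF b *m A i - A i *m slF a =
        (i + 1)%:R *: (if (i < m)%N then A i.+1 else 0)].

End SL2.

(** * Irreducibility of V(a) in characteristic zero *)

Section Irreducible.
Variable F : fieldType.
Hypothesis char0 : [pchar F] =i pred0.
Implicit Types (a b i j k : nat).

Lemma natf_neq0_char0 n : (n%:R == 0 :> F) = (n == 0%N).
Proof. exact: (iffLR (pcharf0P F) char0). Qed.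

Lemma row_nmx a (u : 'rV[F]_a.+1) : u^T = nmx a 0 (fun j _ => u 0 (inord j)).
Proof. by apply/matrixP => j k; rewrite !mxE ord1 inord_val. Qed.

Lemma delta_slE a (i : 'I_a.+1) :
  delta_mx (0 : 'I_1) i *m (slE F a)^T =
  if i == 0%N :> nat then 0 else i%:R *: delta_mx 0 (inord i.-1).
Proof.
rewrite -rowE; apply/rowP => j; case: eqP => [i0|/eqP i0]; rewrite !mxE.
  by rewrite i0.
rewrite eqxx -val_eqE /= inordK; last exact: leq_ltn_trans (leq_pred _) (ltn_ord i).
rewrite -[X in _.+1 == X]prednK ?lt0n // eqSS.
by case: eqP; rewrite ?mulr1 ?mulr0.
Qed.

Lemma delta_slF a (i : 'I_a.+1) :
  delta_mx (0 : 'I_1) i *m (slF F a)^T =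
  if (i < a)%N then (a%:R - i%:R) *: delta_mx 0 (inord i.+1) else 0.
Proof.
rewrite -rowE; apply/rowP => j; case: ifP => [lti|nlti]; rewrite !mxE.
  by rewrite eqxx -val_eqE /= inordK //; case: eqP; rewrite ?mulr1 ?mulr0.
by case: eqP => // ji; have := ltn_ord j; rewrite ji ltnS nlti.
Qed.

Lemma delta_slH a (i : 'I_a.+1) :
  delta_mx (0 : 'I_1) i *m (slH F a)^T = (a%:R - (2 * i)%:R) *: delta_mx 0 i.
Proof.
rewrite -rowE; apply/rowP => j; rewrite !mxE eqxx -val_eqE /=.
by case: eqP; rewrite ?mulr1 ?mulr0.
Qed.

(* A power of e sends a nonzero vector to a nonzero multiple of x^a, and the
   powers of f then reach every monomial. *)
Lemma slV_irreducible a (P : 'rV[F]_a.+1 -> Prop) (y : 'rV[F]_a.+1) :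
  (forall c u v, P u -> P v -> P (c *: u + v)) ->
  (forall u, P u -> P (u *m (slE F a)^T)) ->
  (forall u, P u -> P (u *m (slF F a)^T)) ->
  y != 0 -> P y -> forall u, P u.
Proof.
move=> Plin PE PF y0 Py.
have P0 : P 0 by have := Plin (-1) y y Py Py; rewrite scaleN1r addNr.
have PZ c u : P u -> P (c *: u) by move=> /(Plin c) /(_ P0); rewrite addr0.
(* [n] is the largest index in the support of [v]; each application of [e] lowers it by one and
   multiplies the top coefficient by a positive integer. *)
have Pd0 n v : P v -> (n <= a)%N -> (forall j : 'I_a.+1, (n < j)%N -> v 0 j = 0) ->
    v 0 (inord n) != 0 -> P (delta_mx 0 ord0).
  elim: n v => [|n IHn] v Pv len v0 vn.
    suff -> : delta_mx 0 ord0 = (v 0 (inord 0))^-1 *: v by apply: PZ.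
    apply/rowP => j; rewrite !mxE eqxx /=.
    have [->|nej] := eqVneq j ord0.
      by rewrite -[ord0 in RHS](inord_val ord0) /= mulVf.
    by rewrite (v0 j) ?lt0n // mulr0.
  have coefE (j : 'I_a.+1) : (v *m (slE F a)^T) 0 j =
      if (j < a)%N then j.+1%:R * v 0 (inord j.+1) else 0.
    have -> : v *m (slE F a)^T = (slE F a *m v^T)^T by rewrite trmx_mul trmxK.
    by rewrite row_nmx mul_slE_nmx !mxE.
  apply: (IHn (v *m (slE F a)^T)).
  - exact: PE.
  - exact: ltnW.
  - move=> j ltnj; rewrite coefE; case: ifP => // ltja.
    by rewrite v0 ?inordK // mulr0.
  by rewrite coefE inordK ?len 1?ltnW // mulf_neq0 // natf_neq0_char0.
have {}Pd0 : P (delta_mx 0 ord0).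
  have [j0 yj0] : exists j : 'I_a.+1, y 0 j != 0.
    apply/existsP; apply: contraNT y0 => /existsPn y0.
    by apply/eqP/rowP => j; rewrite mxE; apply/eqP; have := y0 j; rewrite negbK.
  case: (@arg_maxnP _ j0 (fun j : 'I_a.+1 => y 0 j != 0) val yj0) => j yj maxj.
  apply: (Pd0 j y); rewrite ?inord_val // -1?ltnS // => k ltjk.
  by apply/eqP; apply: contraTT ltjk => /maxj; rewrite -leqNgt.
have Pd k : (k <= a)%N -> P (delta_mx 0 (inord k)).
  elim: k => [|k IHk] lek; first by rewrite (_ : inord 0 = ord0) //; apply/val_inj/inordK.
  have /PF := IHk (ltnW lek); rewrite delta_slF inordK ?lek 1?ltnW //.
  (* The factor [a - k] produced by [f] is invertible because [k < a]. *)
  move=> /(PZ (a%:R - k%:R)^-1); rewrite scalerA mulVf ?scale1r //.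
  by rewrite -natrB ?natf_neq0_char0 1?ltnW // subn_eq0 -ltnNge.
move=> u; rewrite [u]row_sum_delta.
elim/big_rec: _ => // i v _; apply: Plin.
by rewrite -[i]inord_val; apply: Pd; rewrite -ltnS.
Qed.

End Irreducible.

(** * Block upper triangular matrices *)

Section Block.
Variable F : fieldType.
Variables p q s : nat.

Definition up3 (D1 : 'M[F]_p) (D2 : 'M[F]_q) (D3 : 'M[F]_s)
    (A12 : 'M[F]_(p, q)) (A13 : 'M[F]_(p, s)) (A23 : 'M[F]_(q, s)) :
    'M[F]_(p + (q + s)) :=
  block_mx D1 (row_mx A12 A13) 0 (block_mx D2 A23 0 D3).

Definition row3 n (u1 : 'M[F]_(n, p)) (u2 : 'M[F]_(n, q)) (u3 : 'M[F]_(n, s)) :=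
  row_mx u1 (row_mx u2 u3).

Lemma mul_up3 D1 D2 D3 A12 A13 A23 D1' D2' D3' A12' A13' A23' :
  up3 D1 D2 D3 A12 A13 A23 *m up3 D1' D2' D3' A12' A13' A23' =
  up3 (D1 *m D1') (D2 *m D2') (D3 *m D3') (D1 *m A12' + A12 *m D2')
      (D1 *m A13' + (A12 *m A23' + A13 *m D3')) (D2 *m A23' + A23 *m D3').
Proof.
rewrite /up3 !mulmx_block mul_mx_row mul_row_block add_row_mx.
by rewrite !(mulmx0, mul0mx, addr0, add0r).
Qed.

Lemma sub_up3 D1 D2 D3 A12 A13 A23 D1' D2' D3' A12' A13' A23' :
  up3 D1 D2 D3 A12 A13 A23 - up3 D1' D2' D3' A12' A13' A23' =
  up3 (D1 - D1') (D2 - D2') (D3 - D3') (A12 - A12') (A13 - A13') (A23 - A23').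
Proof.
by rewrite /up3 !(opp_block_mx, add_block_mx, opp_row_mx, add_row_mx) !subr0.
Qed.

Lemma scale_up3 c D1 D2 D3 A12 A13 A23 :
  c *: up3 D1 D2 D3 A12 A13 A23 =
  up3 (c *: D1) (c *: D2) (c *: D3) (c *: A12) (c *: A13) (c *: A23).
Proof. by rewrite /up3 !(scale_block_mx, scale_row_mx) !scaler0. Qed.

Lemma up3_0 : up3 0 0 0 0 0 0 = 0.
Proof. by rewrite /up3 row_mx0 !block_mx0. Qed.

Lemma mul_row3_tr n (u1 : 'M_(n, p)) u2 u3 D1 D2 D3 A12 A13 A23 :
  row3 u1 u2 u3 *m (up3 D1 D2 D3 A12 A13 A23)^T =
  row3 (u1 *m D1^T + (u2 *m A12^T + u3 *m A13^T)) (u2 *m D2^T + u3 *m A23^T)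
       (u3 *m D3^T).
Proof.
rewrite /row3 /up3 !tr_block_mx tr_row_mx !trmx0 !mul_row_block mul_row_col.
by rewrite !mulmx0 !add0r.
Qed.

Lemma row3P n (u : 'M_(n, p + (q + s))) : exists u1 u2 u3, u = row3 u1 u2 u3.
Proof.
by exists (lsubmx u), (lsubmx (rsubmx u)), (rsubmx (rsubmx u)); rewrite /row3 !hsubmxK.
Qed.

Lemma row3D n (u1 : 'M_(n, p)) u2 u3 v1 v2 v3 :
  row3 u1 u2 u3 + row3 v1 v2 v3 = row3 (u1 + v1) (u2 + v2) (u3 + v3).
Proof. by rewrite /row3 !add_row_mx. Qed.

Lemma row3B n (u1 : 'M_(n, p)) u2 u3 v1 v2 v3 :
  row3 u1 u2 u3 - row3 v1 v2 v3 = row3 (u1 - v1) (u2 - v2) (u3 - v3).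
Proof. by rewrite /row3 !(opp_row_mx, add_row_mx). Qed.

Lemma row3Z n c (u1 : 'M_(n, p)) u2 u3 :
  c *: row3 u1 u2 u3 = row3 (c *: u1) (c *: u2) (c *: u3).
Proof. by rewrite /row3 !scale_row_mx. Qed.

Lemma mul_row3 n l (w : 'M_(l, n)) (u1 : 'M_(n, p)) u2 u3 :
  w *m row3 u1 u2 u3 = row3 (w *m u1) (w *m u2) (w *m u3).
Proof. by rewrite /row3 !mul_mx_row. Qed.

Lemma row3_eq0 n (u1 : 'M_(n, p)) u2 u3 :
  (row3 u1 u2 u3 == 0) = [&& u1 == 0, u2 == 0 & u3 == 0].
Proof. by rewrite /row3 !row_mx_eq0. Qed.

(** A coordinate projection, used for its row space. The boolean triples let one definition cover
    every term of the socle series, from [0] to the whole space. *)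
Definition flag (c1 c2 c3 : bool) : 'M[F]_(p + (q + s)) :=
  up3 (c1%:R)%:M (c2%:R)%:M (c3%:R)%:M 0 0 0.

Lemma flag0 : flag false false false = 0.
Proof. by rewrite /flag !raddf0 up3_0. Qed.

Lemma flag1 : flag true true true = 1%:M.
Proof. by rewrite /flag /up3 row_mx0 -!scalar_mx_block. Qed.

(** A row lies in the row space of an idempotent exactly when the idempotent fixes it. *)
Lemma row3_sub_flag n (u1 : 'M_(n, p)) u2 u3 c1 c2 c3 :
  (row3 u1 u2 u3 <= flag c1 c2 c3)%MS =
  [&& c1 || (u1 == 0), c2 || (u2 == 0) & c3 || (u3 == 0)].
Proof.
have flagK : flag c1 c2 c3 *m flag c1 c2 c3 = flag c1 c2 c3.
  by rewrite mul_up3 !mulmx0 !mul0mx !addr0 -!scalar_mxM -!natrM !mulnb !andbb.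
have -> : (row3 u1 u2 u3 <= flag c1 c2 c3)%MS =
    (row3 u1 u2 u3 *m flag c1 c2 c3 == row3 u1 u2 u3).
  apply/idP/eqP => [/submxP[w ->]|<-]; last exact: submxMl.
  by rewrite -mulmxA flagK.
(* The projection is symmetric, which lets [mul_row3_tr] compute the product. *)
have {flagK} -> : flag c1 c2 c3 = (flag c1 c2 c3)^T.
  by rewrite /flag /up3 row_mx0 !tr_block_mx !trmx0 !tr_scalar_mx.
rewrite mul_row3_tr !trmx0 !mulmx0 !addr0 !tr_scalar_mx !mul_mx_scalar.
rewrite -subr_eq0 row3B row3_eq0.
by case: c1 c2 c3 => [] [] []; rewrite !(scale1r, scale0r, subrr, sub0r, oppr_eq0, eqxx).
Qed.

Lemma rank_flag c1 c2 c3 : \rank (flag c1 c2 c3) = (c1 * p + (c2 * q + c3 * s))%N.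
Proof.
have rk n (c : bool) : \rank (c%:R%:M : 'M[F]_n) = (c * n)%N.
  by case: c; rewrite ?mxrank1 ?mul1n // raddf0 mxrank0.
by rewrite /flag /up3 row_mx0 !rank_diag_block_mx !rk.
Qed.

Lemma flag_sub c1 c2 c3 d1 d2 d3 :
  c1 ==> d1 -> c2 ==> d2 -> c3 ==> d3 -> (flag c1 c2 c3 <= flag d1 d2 d3)%MS.
Proof.
move=> cd1 cd2 cd3; apply/rV_subP => v; have [v1 [v2 [v3 ->]]] := row3P v.
have widen (c d e : bool) : c ==> d -> c || e -> d || e by case: c d => [] [].
rewrite !row3_sub_flag => /and3P[/(widen _ _ _ cd1)-> /(widen _ _ _ cd2)->].
exact: widen cd3.
Qed.

End Block.

(** * Faithfulness and uniseriality *)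

Section Faithful.
Variable F : fieldType.

Lemma bra0l d (A : 'M[F]_d) : bra 0 A = 0.
Proof. by rewrite /bra mul0mx mulmx0 subr0. Qed.

Lemma braDl d (A B C : 'M[F]_d) : bra (A + B) C = bra A C + bra B C.
Proof. by rewrite /bra mulmxDl mulmxDr opprD addrACA. Qed.

Lemma braZl d c (A B : 'M[F]_d) : bra (c *: A) B = c *: bra A B.
Proof. by rewrite /bra -scalemxAl -scalemxAr scalerBr. Qed.

Lemma bra_suml d (I : finType) (A : I -> 'M[F]_d) (B : 'M[F]_d) :
  bra (\sum_i A i) B = \sum_i bra (A i) B.
Proof. by rewrite /bra mulmx_suml mulmx_sumr sumrB. Qed.

Lemma braC d (A B : 'M[F]_d) : bra A B = - bra B A.
Proof. by rewrite /bra opprB. Qed.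

(* Bracketing a vanishing element of g twice with suitable v_i isolates its
   coefficients on h, f and e, and then once more those on the v_i. *)
Lemma faithful_center_neq0 m d (r : grep F m d) :
  [pchar F] =i pred0 -> (0 < m)%N -> is_g_rep r -> rZ r != 0 -> faithful r.
Proof.
move=> char0 m0 [_ _ _ _ [HX EX FX XX XZ]] Z0 ce cf ch cz cx T0.
pose w i j : F := if (i + j == m)%N then (-1) ^+ i * ('C(m, i))%:R else 0.
have {}XX i j : bra (rX r i) (rX r j) = w i j *: rZ r.
  by rewrite XX /w; case: eqP; rewrite ?scale0r.
have ZX i : bra (rZ r) (rX r i) = 0 by rewrite braC XZ oppr0.
have wneq0 i j : (i <= m)%N -> (i + j == m)%N -> w i j != 0.
  move=> lei ij; rewrite /w ij mulf_neq0 ?signr_eq0 //.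
  by rewrite natf_neq0_char0 // -lt0n bin_gt0.
have w0 i j : (i + j != m)%N -> w i j = 0 by rewrite /w => /negPf->.
have Zreg c : c *: rZ r = 0 -> c = 0.
  by move/eqP; rewrite scaler_eq0 (negPf Z0) orbF => /eqP.
(* [D j] is the bracket of the sl(2)-part with [v_j]; [K j] is the coefficient of [z] contributed by
   the Heisenberg part. *)
pose D j := ce *: bra (rE r) (rX r j) + cf *: bra (rF r) (rX r j)
  + ch *: bra (rH r) (rX r j).
pose K (j : 'I_m.+1) := \sum_i cx i * w i j.
have DK j : D j + K j *: rZ r = 0.
  have := congr1 (fun T => bra T (rX r j)) T0.
  rewrite bra0l !braDl !braZl bra_suml ZX scaler0 addr0 => <-.
  rewrite /D /K scaler_suml; congr (_ + _); apply: eq_bigr => i _.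
  by rewrite braZl XX scalerA.
(* A second bracket kills the multiple of [z] and leaves only the sl(2)-coefficients. *)
have D2 j l : bra (D j) (rX r l) = 0.
  have := congr1 (fun T => bra T (rX r l)) (DK j).
  by rewrite bra0l braDl braZl ZX scaler0 addr0.
have {}D2 (j l : 'I_m.+1) : ce * (if j == 0%N :> nat then 0 else (m - j + 1)%:R * w j.-1 l)
    + cf * (if (j < m)%N then (j + 1)%:R * w j.+1 l else 0)
    + ch * ((m%:R - (2 * j)%:R) * w j l) = 0.
  apply: Zreg; rewrite !scalerDl -!scalerA -[RHS](D2 j l) /D !braDl !braZl.
  rewrite HX EX FX !braZl XX; congr (_ + _ + _); congr (_ *: _).
    case: eqP => [_|/eqP j0]; first by rewrite scale0r bra0l.
    rewrite braZl -scalerA /rXs (leq_trans (leq_pred _)) -1?ltnS //.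
    by rewrite XX inordK // (leq_ltn_trans (leq_pred _)).
  rewrite /rXs; case: ifP => ltj; rewrite ?bra0l ?scaler0 ?scale0r //.
  by rewrite XX inordK // scalerA.
have nat0 n c : (0 < n)%N -> c * n%:R = 0 :> F -> c = 0.
  move=> n0 /eqP; rewrite mulf_eq0 natf_neq0_char0 //.
  by rewrite -[n == _]negbK -lt0n n0 orbF => /eqP.
have wK c i j : (i <= m)%N -> (i + j == m)%N -> c * w i j = 0 -> c = 0.
  move=> lei ij /eqP; rewrite mulf_eq0 (negPf (wneq0 i j lei ij)) orbF.
  by move/eqP.
(* On the pair [v_0], [v_m]: [e] kills [v_0], and [f v_0 = v_1] is orthogonal to [v_m]. *)
have ch0 : ch = 0.
  have := D2 ord0 ord_max; rewrite /= m0 mulr0 add0r [w 1%N m]w0; last by lia.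
  rewrite !mulr0 add0r muln0 subr0 mulrA => /(wK _ 0%N m) -/(_ isT).
  by rewrite add0n eqxx => /(_ isT)/nat0; apply.
(* [f v_0 = v_1] pairs nontrivially with [v_(m-1)]. *)
have cf0 : cf = 0.
  have := D2 ord0 (inord m.-1).
  rewrite /= inordK; last by lia.
  rewrite m0 ch0 mul0r addr0 mulr0 add0r mulrA.
  by move/(wK _ 1%N m.-1 m0); rewrite add1n prednK // eqxx => /(_ isT)/nat0; apply.
(* [f] kills [v_m], and [e v_m = v_(m-1)] pairs nontrivially with [v_1]. *)
have ce0 : ce = 0.
  have := D2 ord_max (inord 1); rewrite /= inordK // ltnn mulr0 addr0 ch0 mul0r.
  rewrite addr0 -[m == 0%N]negbK -lt0n m0 /= subnn add0n mul1r.
  by apply: wK; rewrite ?leq_pred // addn1 prednK.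
have D0 j : D j = 0 by rewrite /D ch0 cf0 ce0 !scale0r !addr0.
(* Among the [v_k], only [v_i] pairs nontrivially with [v_(m-i)], the vector indexed by
   [rev_ord i]. *)
have cx0 i : cx i = 0.
  have := DK (rev_ord i); rewrite D0 add0r => /Zreg; rewrite /K (bigD1 i) //=.
  rewrite big1 ?addr0 => [|k neki]; last first.
    rewrite w0 ?mulr0 //=; apply: contraNneq neki => km.
    by apply/eqP/val_inj => /=; have := ltn_ord i; have := ltn_ord k; lia.
  have lei : (i <= m)%N by rewrite -ltnS.
  by apply: (wK _ i (rev_ord i) lei); rewrite /= subSS subnKC.
split=> //; apply: Zreg; rewrite -[RHS]T0 ce0 cf0 ch0 !scale0r !add0r.
by rewrite big1 ?add0r // => i _; rewrite cx0 scale0r.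
Qed.

End Faithful.

(** * Socle steps and irreducible factors of a representation *)

Section Uniserial.
Variables (F : fieldType) (m d : nat) (r : grep F m d).
Implicit Types U S Y W : 'M[F]_d.

(** Stronger than minimality: [S] lies in every stable subspace strictly above [U]. This one
    condition yields both the minimality and the socle clauses of [uniserial3]. *)
Definition least_over U S :=
  [/\ stable r U, stable r S, (U < S)%MS &
      forall Y, stable r Y -> (U <= Y)%MS -> ~~ (Y <= U)%MS -> (S <= Y)%MS].

Lemma least_over_minimal U S : least_over U S -> minimal_over r U S.
Proof.
move=> [stU stS ltUS minS]; split=> // Y stY leUY leYS.
have [leYU|nleYU] := boolP (Y <= U)%MS; [left|right]; first exact/andP.
by apply/andP; split=> //; apply: minS.
Qed.

(** A minimal stable [W] over [U] contains [S] by leastness, hence equals it by its own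
    minimality. *)
Lemma least_over_socle U S : least_over U S -> is_socle r U S.
Proof.
move=> lstS; have [stU stS ltUS minS] := lstS; split=> //; first exact: ltmxW.
- move=> W [_ stW ltUW minW].
  have leSW : (S <= W)%MS by case/andP: (ltUW) => _; apply: minS => //; apply: ltmxW.
  case: (minW S stS (ltmxW ltUS) leSW) => /andP[leSU leWS] //.
  by case/andP: ltUS => _; rewrite leSU.
exists 1%N, (fun=> S); split=> [_|]; first exact: least_over_minimal.
by rewrite big_ord1 addsmxSr /= addsmx_sub ltmxW ?submx_refl.
Qed.

(** Row [i] of [J] stands for the monomial [x^(a-i) y^i]. Multiplying it by ['C(a, i)], nonzero in
    characteristic zero, gives the basis normalised as in [factor_is_V] and keeps the row space. *)
Lemma factor_is_VI U W a (J : 'M[F]_(a.+1, d)) :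
  (W == U + J)%MS -> \rank W = (\rank U + a.+1)%N ->
  (J *m (rE r)^T - (slE F a)^T *m J <= U)%MS ->
  (J *m (rF r)^T - (slF F a)^T *m J <= U)%MS ->
  (J *m (rH r)^T - (slH F a)^T *m J <= U)%MS ->
  [pchar F] =i pred0 ->
  factor_is_V r U W a.
Proof.
move=> WUJ rkW JE JF JH char0.
pose B : 'M[F]_(a.+1, d) := \matrix_i ('C(a, i)%:R *: row i J).
have rowB i : row i B = 'C(a, i)%:R *: row i J by rewrite rowK.
have binr0 (i : 'I_a.+1) : 'C(a, i)%:R != 0 :> F.
  by rewrite natf_neq0_char0 // -lt0n bin_gt0 -ltnS.
have eqBJ : (B :=: J)%MS.
  apply/eqmxP/andP; split; apply/row_subP => i.
    by rewrite rowB scalemx_sub // row_sub.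
  rewrite -[row i J]scale1r -(mulVf (binr0 i)) -scalerA -rowB.
  by rewrite scalemx_sub // row_sub.
have rowact (M : 'M_d) (N : 'M_a.+1) i : (J *m M^T - N^T *m J <= U)%MS ->
    (row i B *m M^T - 'C(a, i)%:R *: (delta_mx (0 : 'I_1) i *m N^T *m J) <= U)%MS.
  move=> JM; rewrite rowB rowE -!scalemxAl -scalerBr scalemx_sub //.
  by rewrite -!mulmxA -mulmxBr (submx_trans (submxMl _ _)).
exists B; split.
- apply/eqmxP; apply: eqmx_trans (eqmxP WUJ) _.
  exact: adds_eqmx (eqmx_refl _) (eqmx_sym eqBJ).
- by rewrite (adds_eqmx (eqmx_refl _) eqBJ) -(eqmxP WUJ).
- move=> i; have := rowact _ _ i JH; congr (_ - _ <= _)%MS.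
  by rewrite delta_slH -scalemxAl -rowE rowB scalerA mulrC -scalerA.
- move=> i; have := rowact _ _ i JE; congr (_ - _ <= _)%MS.
  rewrite delta_slE; case: eqP => [_|/eqP i0]; first by rewrite mul0mx scaler0.
  have lti := ltn_ord i.
  rewrite -scalemxAl -rowE (leq_trans (leq_pred _)) -1?ltnS // rowB inordK; last by lia.
  rewrite !scalerA -!natrM; congr (_%:R *: _).
  have := mul_bin_left a i.-1; rewrite prednK ?lt0n // mulnC => ->.
  by congr (_ * _)%N; lia.
move=> i; have := rowact _ _ i JF; congr (_ - _ <= _)%MS.
rewrite delta_slF; case: ifP => [lti|_]; last by rewrite mul0mx !scaler0.
rewrite -scalemxAl -rowE rowB inordK // !scalerA; congr (_ *: _).
by rewrite -natrB 1?ltnW // -!natrM mulnC addn1 mul_bin_left.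
Qed.

End Uniserial.

(** * The three-block module attached to a pair of equivariant maps *)

Section ThreeBlocks.
Variable F : fieldType.
Variables (m a b : nat) (A : nat -> 'M[F]_(b.+1, a.+1)).
Variables (B : nat -> 'M[F]_(a.+1, b.+1)) (g : F).
Hypotheses (char0 : [pchar F] =i pred0) (m_gt0 : (0 < m)%N) (g_neq0 : g != 0).
Hypotheses (intA : intertwiner m A) (intB : intertwiner m B).
Hypothesis commBA : forall i j, (i <= m)%N -> (j <= m)%N ->
  B i *m A j - B j *m A i =
    (if (i + j == m)%N then (-1) ^+ i * ('C(m, i))%:R * g else 0)%:M.

Definition block_rep : grep F m (a.+1 + (b.+1 + a.+1)) :=
  GRep (up3 (slE F a) (slE F b) (slE F a) 0 0 0)
       (up3 (slF F a) (slF F b) (slF F a) 0 0 0)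
       (up3 (slH F a) (slH F b) (slH F a) 0 0 0)
       (fun i : 'I_m.+1 => up3 0 0 0 (B i) 0 (A i))
       (up3 0 0 0 0 g%:M 0).

Lemma rXs_block_rep k :
  rXs block_rep k = if (k <= m)%N then up3 0 0 0 (B k) 0 (A k) else 0.
Proof. by rewrite /rXs; case: ifP => //= lek; rewrite inordK. Qed.

Lemma bra_diag_up3 p q s (D1 D1' : 'M[F]_p) (D2 D2' : 'M[F]_q) (D3 D3' : 'M[F]_s)
    X12 X13 X23 :
  bra (up3 D1 D2 D3 0 0 0) (up3 D1' D2' D3' X12 X13 X23) =
  up3 (bra D1 D1') (bra D2 D2') (bra D3 D3') (D1 *m X12 - X12 *m D2)
      (D1 *m X13 - X13 *m D3) (D2 *m X23 - X23 *m D3).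
Proof.
by rewrite /bra !mul_up3 sub_up3 !(mul0mx, mulmx0, addr0, add0r).
Qed.

Lemma bra_nil_up3 p q s (X12 X12' : 'M[F]_(p, q)) (X13 X13' : 'M[F]_(p, s)) X23 X23' :
  bra (up3 0 0 0 X12 X13 X23) (up3 0 0 0 X12' X13' X23') =
  up3 0 0 0 0 (X12 *m X23' - X12' *m X23) 0.
Proof.
by rewrite /bra !mul_up3 sub_up3 !(mul0mx, mulmx0, addr0, add0r, oppr0).
Qed.

(** Block by block: the diagonal gives the sl(2)-relations, [intA] and [intB] the brackets with the
    [v_i], and [commBA] the bracket of two [v_i], which has only a corner block. *)
Lemma block_repP : is_g_rep block_rep.
Proof.
have bra0r n (M : 'M[F]_n) : bra M 0 = 0 by rewrite braC bra0l oppr0.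
split=> /=.
- by rewrite bra_diag_up3 !bra_slHE !mulmx0 !mul0mx !subr0 scale_up3 !scaler0.
- rewrite bra_diag_up3 !bra_slHF !mulmx0 !mul0mx !subr0.
  by rewrite -[RHS]scaleNr scale_up3 !scaler0 !scaleNr.
- by rewrite bra_diag_up3 !bra_slEF !mulmx0 !mul0mx !subr0.
- rewrite !bra_diag_up3 !bra0r !mulmx0 !mul0mx !scalar_mxC !subrr.
  by rewrite up3_0.
split=> [i|i|i|i j|i] /=.
- have lei : (i <= m)%N by rewrite -ltnS.
  have [HA _ _] := intA lei; have [HB _ _] := intB lei.
  by rewrite bra_diag_up3 !bra0r HA HB !mulmx0 !mul0mx !subr0 scale_up3 !scaler0.
- have lei : (i <= m)%N by rewrite -ltnS.
  have [_ EA _] := intA lei; have [_ EB _] := intB lei.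
  rewrite bra_diag_up3 !bra0r EA EB !mulmx0 !mul0mx !subr0 rXs_block_rep.
  case: eqP => _; first by rewrite up3_0.
  by rewrite (leq_trans (leq_pred _)) // scale_up3 !scaler0.
- have lei : (i <= m)%N by rewrite -ltnS.
  have [_ _ FA] := intA lei; have [_ _ FB] := intB lei.
  rewrite bra_diag_up3 !bra0r FA FB !mulmx0 !mul0mx !subr0 rXs_block_rep.
  case: ifP => _; last by rewrite !scaler0 up3_0.
  by rewrite scale_up3 !scaler0.
- rewrite bra_nil_up3 commBA -1?ltnS //.
  case: eqP => _; last by rewrite raddf0 up3_0.
  by rewrite scale_up3 !scaler0 scale_scalar_mx.
by rewrite bra_nil_up3 mulmx0 mul0mx subrr up3_0.
Qed.

Lemma block_rep_center_neq0 : rZ block_rep != 0.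
Proof.
apply/eqP => /(congr1 (fun M => usubmx M)) /(congr1 (fun M => rsubmx (rsubmx M))).
rewrite /= /up3 /block_mx col_mxKu !row_mxKr !linear0.
by move/matrixP/(_ ord0 ord0)/eqP; rewrite !mxE eqxx (negPf g_neq0).
Qed.

(** The implications make the flag an initial run of blocks, and an upper triangular matrix moves
    coordinates only towards earlier blocks. *)
Lemma flag_stable p q s (c1 c2 c3 : bool) (D1 : 'M[F]_p) (D2 : 'M[F]_q)
    (D3 : 'M[F]_s) X12 X13 X23 :
  c3 ==> c2 -> c2 ==> c1 ->
  (flag F p q s c1 c2 c3 *m (up3 D1 D2 D3 X12 X13 X23)^T <= flag F p q s c1 c2 c3)%MS.
Proof.
move=> c32 c21; have [f1 [f2 [f3 eqf]]] := row3P (flag F p q s c1 c2 c3).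
have := submx_refl (flag F p q s c1 c2 c3).
rewrite {1 3}eqf mul_row3_tr !row3_sub_flag => /and3P[].
case: c1 c2 c3 c32 c21 {eqf} => [] [] [] //= _ _;
  do 3![move=> /eqP-> | move=> _]; by rewrite ?mul0mx ?addr0 ?eqxx.
Qed.

Lemma stable_flag c1 c2 c3 :
  c3 ==> c2 -> c2 ==> c1 -> stable block_rep (flag F a.+1 b.+1 a.+1 c1 c2 c3).
Proof. by move=> c32 c21; split=> [||||i]; apply: flag_stable. Qed.

(** The commutator for the pair [(0, m)] is [g] times the identity, so a vector killed by [A 0] and
    [A m] is killed by [g]. *)
Lemma A_nondegenerate (y : 'rV[F]_a.+1) :
  (forall i, (i <= m)%N -> y *m (A i)^T = 0) -> y = 0.
Proof.
move=> yA0; have := congr1 (fun M => y *m M^T) (commBA (leq0n m) (leqnn m)).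
rewrite add0n eqxx bin0 expr0 !mul1r linearB /= !trmx_mul mulmxBr !mulmxA !yA0 //.
rewrite !mul0mx subrr tr_scalar_mx mul_mx_scalar => /esym/eqP.
by rewrite scaler_eq0 (negPf g_neq0) => /eqP.
Qed.

(* The common kernel of the v_i is an sl(2)-submodule of the irreducible V(b). *)
Lemma B_nondegenerate (y : 'rV[F]_b.+1) :
  (forall i, (i <= m)%N -> y *m (B i)^T = 0) -> y = 0.
Proof.
move=> yB0; apply/eqP/contraT => y0.
(* The common kernel is stable under [N] as soon as the defects [N' B_i - B_i N] vanish on it; for
   [e] and [f] these are multiples of some [B_j], or zero. *)
have kerB (N : 'M[F]_b.+1) (N' : 'M[F]_a.+1) (C : nat -> 'M[F]_(a.+1, b.+1)) :
    (forall i, (i <= m)%N -> N' *m B i - B i *m N = C i) ->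
    (forall u : 'rV_b.+1, (forall i, (i <= m)%N -> u *m (B i)^T = 0) ->
       forall i, (i <= m)%N -> u *m (C i)^T = 0) ->
    forall u : 'rV_b.+1, (forall i, (i <= m)%N -> u *m (B i)^T = 0) ->
    forall i, (i <= m)%N -> u *m N^T *m (B i)^T = 0.
  move=> NB uC u uB i lei; rewrite -mulmxA -trmx_mul.
  have -> : B i *m N = N' *m B i - C i by rewrite -NB // opprB addrC subrK.
  by rewrite linearB /= trmx_mul mulmxBr mulmxA uB // mul0mx uC // subrr.
have allB := @slV_irreducible F char0 b
  (fun u => forall i, (i <= m)%N -> u *m (B i)^T = 0) y.
have {}allB : forall u : 'rV[F]_b.+1, forall i, (i <= m)%N -> u *m (B i)^T = 0.
  apply: allB => // [c u v uB vB i lei||].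
  - by rewrite mulmxDl -scalemxAl uB // vB // scaler0 addr0.
  - apply: (kerB _ (slE F a) (fun i => if i == 0%N then 0 else (m - i + 1)%:R *: B i.-1)) =>
       [i lei|u uB i lei]; first by have [_ ->] := intB lei.
    case: eqP => _; first by rewrite trmx0 mulmx0.
    by rewrite linearZ /= -scalemxAr uB ?scaler0 // (leq_trans (leq_pred _)).
  - apply: (kerB _ (slF F a) (fun i => (i + 1)%:R *: (if (i < m)%N then B i.+1 else 0))) =>
       [i lei|u uB i lei]; first by have [_ _ ->] := intB lei.
    by rewrite linearZ /= -scalemxAr; case: ifP => lti; rewrite ?uB // ?trmx0 ?mulmx0 scaler0.
(* All [B i] vanish, which contradicts the value [g] of the commutator for [(0, m)]. *)
have B0 i : (i <= m)%N -> B i = 0.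
  move=> lei; apply: trmx_inj; rewrite trmx0; apply/row_matrixP => k.
  by rewrite rowE allB // row0.
have := commBA (leq0n m) (leqnn m).
rewrite add0n eqxx bin0 expr0 !mul1r !B0 // !mul0mx subrr.
by move/matrixP/(_ ord0 ord0)/eqP; rewrite !mxE eqxx eq_sym (negPf g_neq0).
Qed.

(** * Stable subspaces of the three-block module *)

Section StableSubspace.
Variable Y : 'M[F]_(a.+1 + (b.+1 + a.+1)).
Hypothesis stY : stable block_rep Y.

Let actE (v : 'rV_(a.+1 + (b.+1 + a.+1))) : (v <= Y)%MS -> (v *m (rE block_rep)^T <= Y)%MS.
Proof. by case: stY => YE _ _ _ _ vY; apply: submx_trans YE; apply: submxMr. Qed.

Let actF (v : 'rV_(a.+1 + (b.+1 + a.+1))) : (v <= Y)%MS -> (v *m (rF block_rep)^T <= Y)%MS.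
Proof. by case: stY => _ YF _ _ _ vY; apply: submx_trans YF; apply: submxMr. Qed.

Let actX (v : 'rV_(a.+1 + (b.+1 + a.+1))) i : (v <= Y)%MS -> (v *m (rX block_rep i)^T <= Y)%MS.
Proof. by case: stY => _ _ _ _ YX vY; apply: submx_trans (YX i); apply: submxMr. Qed.

Let actZ (v : 'rV_(a.+1 + (b.+1 + a.+1))) : (v <= Y)%MS -> (v *m (rZ block_rep)^T <= Y)%MS.
Proof. by case: stY => _ _ _ YZ _ vY; apply: submx_trans YZ; apply: submxMr. Qed.

(** Since [e] and [f] act block-diagonally, the vectors of [Y] supported on one block form an
    sl(2)-submodule of an irreducible module. The same argument serves the other two blocks. *)
Lemma block1_sub (y u : 'rV[F]_a.+1) :
  y != 0 -> (row3 y (0 : 'rV_b.+1) (0 : 'rV_a.+1) <= Y)%MS ->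
  (row3 u (0 : 'rV_b.+1) (0 : 'rV_a.+1) <= Y)%MS.
Proof.
move=> y0 yY; move: u.
apply: (slV_irreducible char0 (P := fun u => (row3 u 0 0 <= Y)%MS) _ _ _ y0 yY).
- move=> c u v uY vY; have := addmx_sub (scalemx_sub c uY) vY.
  by rewrite row3Z row3D !scaler0 !addr0.
- by move=> u /actE; rewrite mul_row3_tr !mul0mx !addr0.
- by move=> u /actF; rewrite mul_row3_tr !mul0mx !addr0.
Qed.

Lemma block2_sub (y u : 'rV[F]_b.+1) :
  y != 0 -> (row3 (0 : 'rV_a.+1) y (0 : 'rV_a.+1) <= Y)%MS ->
  (row3 (0 : 'rV_a.+1) u (0 : 'rV_a.+1) <= Y)%MS.
Proof.
move=> y0 yY; move: u.
apply: (slV_irreducible char0 (P := fun u => (row3 0 u 0 <= Y)%MS) _ _ _ y0 yY).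
- move=> c u v uY vY; have := addmx_sub (scalemx_sub c uY) vY.
  by rewrite row3Z row3D !scaler0 !addr0.
- by move=> u /actE; rewrite mul_row3_tr !trmx0 !mulmx0 !mul0mx !addr0.
- by move=> u /actF; rewrite mul_row3_tr !trmx0 !mulmx0 !mul0mx !addr0.
Qed.

Lemma block3_sub (y u : 'rV[F]_a.+1) :
  y != 0 -> (row3 (0 : 'rV_a.+1) (0 : 'rV_b.+1) y <= Y)%MS ->
  (row3 (0 : 'rV_a.+1) (0 : 'rV_b.+1) u <= Y)%MS.
Proof.
move=> y0 yY; move: u.
apply: (slV_irreducible char0 (P := fun u => (row3 0 0 u <= Y)%MS) _ _ _ y0 yY).
- move=> c u v uY vY; have := addmx_sub (scalemx_sub c uY) vY.
  by rewrite row3Z row3D !scaler0 !addr0.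
- by move=> u /actE; rewrite mul_row3_tr !trmx0 !mulmx0 !mul0mx !addr0.
- by move=> u /actF; rewrite mul_row3_tr !trmx0 !mulmx0 !mul0mx !addr0.
Qed.

Lemma exists_nonzero_image n l (C : nat -> 'M[F]_(l, n)) (y : 'rV[F]_n) :
  ((forall i, (i <= m)%N -> y *m (C i)^T = 0) -> y = 0) ->
  y != 0 -> exists i : 'I_m.+1, y *m (C i)^T != 0.
Proof.
move=> ndeg y0; apply/existsP; apply: contraNT y0 => /existsPn yC.
apply/eqP/ndeg => i lei; apply/eqP; have := yC (inord i).
by rewrite negbK inordK.
Qed.

(** A nonzero vector of the first block is reached through [z] if [v3] is nonzero, through some
    [v_i] if [v3 = 0] and [v2] is nonzero, and is the given vector otherwise. *)
Lemma flag1_sub (v1 : 'rV_a.+1) (v2 : 'rV_b.+1) (v3 : 'rV_a.+1) :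
  (row3 v1 v2 v3 <= Y)%MS -> row3 v1 v2 v3 != 0 ->
  (flag F a.+1 b.+1 a.+1 true false false <= Y)%MS.
Proof.
move=> vY v0; have [y y0 yY] : exists2 y, y != 0 & (row3 y (0 : 'rV_b.+1) (0 : 'rV_a.+1) <= Y)%MS.
  have [v30|v3n0] := eqVneq v3 0; last first.
    exists (g *: v3); first by rewrite scaler_eq0 (negPf g_neq0).
    have := actZ vY; rewrite mul_row3_tr !trmx0 !mulmx0 tr_scalar_mx mul_mx_scalar.
    by rewrite !add0r.
  have [v20|v2n0] := eqVneq v2 0.
    exists v1; last by rewrite -{1}v20 -v30.
    by apply: contraNneq v0 => ->; rewrite row3_eq0 v20 v30 !eqxx.
  have [i yi] := exists_nonzero_image (@B_nondegenerate v2) v2n0.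
  exists (v2 *m (B i)^T) => //; have := actX i vY.
  by rewrite mul_row3_tr v30 !mul0mx !trmx0 !mulmx0 !addr0 add0r.
apply/rV_subP => w; have [w1 [w2 [w3 ->]]] := row3P w.
by rewrite row3_sub_flag => /and3P[_ /= /eqP-> /eqP->]; apply: block1_sub yY.
Qed.

(** If [v3] is nonzero, some [v_i] moves it to a nonzero second component and clears the third
    block. The first component is then subtracted, as [Y] contains the first block. *)
Lemma flag2_sub (v1 : 'rV_a.+1) (v2 : 'rV_b.+1) (v3 : 'rV_a.+1) :
  (flag F a.+1 b.+1 a.+1 true false false <= Y)%MS ->
  (row3 v1 v2 v3 <= Y)%MS -> (v2 != 0) || (v3 != 0) ->
  (flag F a.+1 b.+1 a.+1 true true false <= Y)%MS.
Proof.
move=> leY vY v0.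
have b1 (u : 'rV_a.+1) : (row3 u (0 : 'rV_b.+1) (0 : 'rV_a.+1) <= Y)%MS.
  by apply: submx_trans leY; rewrite row3_sub_flag !eqxx.
have [y y0 yY] : exists2 y, y != 0 & (row3 (0 : 'rV_a.+1) y (0 : 'rV_a.+1) <= Y)%MS.
  suff [y1 [y2 y20 yY]] : exists y1 : 'rV_a.+1, exists2 y2 : 'rV_b.+1, y2 != 0 &
      (row3 y1 y2 (0 : 'rV_a.+1) <= Y)%MS.
    exists y2 => //; have := addmx_sub yY (b1 (- y1)).
    by rewrite row3D subrr !addr0.
  have [v30|v3n0] := eqVneq v3 0.
    by move: v0; rewrite v30 eqxx orbF => v20; exists v1, v2 => //; rewrite -v30.
  have [i yi] := exists_nonzero_image (@A_nondegenerate v3) v3n0.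
  exists (v2 *m (B i)^T), (v3 *m (A i)^T) => //; have := actX i vY.
  by rewrite mul_row3_tr !trmx0 !mulmx0 !addr0 !add0r.
apply/rV_subP => w; have [w1 [w2 [w3 ->]]] := row3P w.
rewrite row3_sub_flag => /and3P[_ _ /= /eqP->].
by have := addmx_sub (b1 w1) (block2_sub w2 y0 yY); rewrite row3D !addr0 add0r.
Qed.

Lemma flag3_sub (v1 : 'rV_a.+1) (v2 : 'rV_b.+1) (v3 : 'rV_a.+1) :
  (flag F a.+1 b.+1 a.+1 true true false <= Y)%MS ->
  (row3 v1 v2 v3 <= Y)%MS -> v3 != 0 ->
  (flag F a.+1 b.+1 a.+1 true true true <= Y)%MS.
Proof.
move=> leY vY v30.
have b12 (u1 : 'rV_a.+1) (u2 : 'rV_b.+1) : (row3 u1 u2 (0 : 'rV_a.+1) <= Y)%MS.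
  by apply: submx_trans leY; rewrite row3_sub_flag !eqxx.
have yY : (row3 (0 : 'rV_a.+1) (0 : 'rV_b.+1) v3 <= Y)%MS.
  by have := addmx_sub vY (b12 (- v1) (- v2)); rewrite row3D !subrr addr0.
apply/rV_subP => w _; have [w1 [w2 [w3 ->]]] := row3P w.
by have := addmx_sub (b12 w1 w2) (block3_sub w3 v30 yY); rewrite row3D !addr0 add0r.
Qed.

End StableSubspace.

Let flag3 := flag F a.+1 b.+1 a.+1.

Lemma flag_lt c2 c3 d1 d2 d3 c1 :
  c1 ==> d1 -> c2 ==> d2 -> c3 ==> d3 -> (c1 + c2 + c3 < d1 + d2 + d3)%N ->
  (flag3 c1 c2 c3 < flag3 d1 d2 d3)%MS.
Proof.
move=> cd1 cd2 cd3 ltcd; rewrite ltmxErank flag_sub // !rank_flag.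
case: c1 c2 c3 d1 d2 d3 cd1 cd2 cd3 ltcd => [] [] [] [] [] [] //= _ _ _ _;
  by rewrite ?mul1n ?mul0n; lia.
Qed.

Lemma least_flag1 : least_over block_rep (flag3 false false false) (flag3 true false false).
Proof.
split=> [|||Y stY _ /row_subPn[i]]; try exact: stable_flag; first exact: flag_lt.
have [v1 [v2 [v3 eqv]]] := row3P (row i Y).
rewrite /flag3 flag0 submx0 eqv; apply: flag1_sub => //.
by rewrite -eqv row_sub.
Qed.

Lemma least_flag2 : least_over block_rep (flag3 true false false) (flag3 true true false).
Proof.
split=> [|||Y stY leY /row_subPn[i]]; try exact: stable_flag; first exact: flag_lt.
have [v1 [v2 [v3 eqv]]] := row3P (row i Y).
rewrite eqv row3_sub_flag /= negb_and => v0.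
by apply: (flag2_sub (v1 := v1) stY leY _ v0); rewrite -eqv row_sub.
Qed.

Lemma least_flag3 : least_over block_rep (flag3 true true false) (flag3 true true true).
Proof.
split=> [|||Y stY leY /row_subPn[i]]; try exact: stable_flag; first exact: flag_lt.
have [v1 [v2 [v3 eqv]]] := row3P (row i Y).
rewrite eqv row3_sub_flag /= => v0.
by apply: (flag3_sub (v1 := v1) (v2 := v2) stY leY _ v0); rewrite -eqv row_sub.
Qed.

(** The witness [J] is the inclusion of the block. It intertwines the sl(2)-actions exactly, since
    these are block-diagonal. The other two factors are treated alike. *)
Lemma factor_flag1 :
  factor_is_V block_rep (flag3 false false false) (flag3 true false false) a.
Proof.
apply: (factor_is_VI
  (J := row3 (1%:M : 'M[F]_a.+1) (0 : 'M_(_, b.+1)) (0 : 'M_(_, a.+1)))) char0.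
- apply/andP; split; last by rewrite addsmx_sub flag_sub // row3_sub_flag !eqxx.
  apply/rV_subP => v; have [v1 [v2 [v3 ->]]] := row3P v.
  rewrite row3_sub_flag => /and3P[_ /= /eqP-> /eqP->].
  apply: submx_trans (addsmxSr _ _); apply/submxP; exists v1.
  by rewrite mul_row3 mulmx1 !mulmx0.
- by rewrite !rank_flag; lia.
all: rewrite mul_row3_tr mul_row3 row3B row3_sub_flag.
all: by rewrite !(mul1mx, mul0mx, mulmx1, mulmx0, trmx0, addr0, add0r, subrr, oppr0, eqxx, orbT).
Qed.

Lemma factor_flag2 :
  factor_is_V block_rep (flag3 true false false) (flag3 true true false) b.
Proof.
apply: (factor_is_VI
  (J := row3 (0 : 'M_(_, a.+1)) (1%:M : 'M[F]_b.+1) (0 : 'M_(_, a.+1)))) char0.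
- apply/andP; split; last by rewrite addsmx_sub flag_sub // row3_sub_flag !eqxx.
  apply/rV_subP => v; have [v1 [v2 [v3 ->]]] := row3P v.
  rewrite row3_sub_flag => /and3P[_ _ /= /eqP->].
  have -> : row3 v1 v2 0 = row3 v1 0 0 + @row3 F a.+1 b.+1 a.+1 1 0 v2 0
    by rewrite row3D !addr0 add0r.
  apply: addmx_sub_adds; first by rewrite row3_sub_flag !eqxx.
  by apply/submxP; exists v2; rewrite mul_row3 mulmx1 !mulmx0.
- by rewrite !rank_flag; lia.
all: rewrite mul_row3_tr mul_row3 row3B row3_sub_flag.
all: by rewrite !(mul1mx, mul0mx, mulmx1, mulmx0, trmx0, addr0, add0r, subrr, oppr0, eqxx, orbT).
Qed.

Lemma factor_flag3 :
  factor_is_V block_rep (flag3 true true false) (flag3 true true true) a.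
Proof.
apply: (factor_is_VI
  (J := row3 (0 : 'M_(_, a.+1)) (0 : 'M_(_, b.+1)) (1%:M : 'M[F]_a.+1))) char0.
- apply/andP; split; last by rewrite addsmx_sub flag_sub // row3_sub_flag.
  apply/rV_subP => v _; have [v1 [v2 [v3 ->]]] := row3P v.
  have -> : row3 v1 v2 v3 = row3 v1 v2 0 + @row3 F a.+1 b.+1 a.+1 1 0 0 v3
    by rewrite row3D !addr0 add0r.
  apply: addmx_sub_adds; first by rewrite row3_sub_flag !eqxx.
  by apply/submxP; exists v3; rewrite mul_row3 mulmx1 !mulmx0.
- by rewrite !rank_flag; lia.
all: rewrite mul_row3_tr mul_row3 row3B row3_sub_flag.
all: by rewrite !(mul1mx, mul0mx, mulmx1, mulmx0, trmx0, addr0, add0r, subrr, oppr0, eqxx, orbT).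
Qed.

Lemma block_rep_uniserial : uniserial3 block_rep a b a.
Proof.
exists (flag3 true false false), (flag3 true true false).
have l1 := least_flag1; have l2 := least_flag2; have l3 := least_flag3.
have f1 := factor_flag1; have f3 := factor_flag3.
rewrite /flag3 ?flag0 ?flag1 in l1 l3 f1 f3 *.
split; try exact: least_over_socle.
split; try exact: least_over_minimal.
by split=> //; apply: factor_flag2.
Qed.

Lemma exists_uniserial_block_rep :
  exists (d : nat) (r : grep F m d), [/\ is_g_rep r, faithful r & uniserial3 r a b a].
Proof.
exists (a.+1 + (b.+1 + a.+1))%N, block_rep; split; first exact: block_repP.
  exact: faithful_center_neq0 char0 m_gt0 block_repP block_rep_center_neq0.
exact: block_rep_uniserial.
Qed.

End ThreeBlocks.

(** * Equivariant maps between irreducible modules *)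

Section Bands.
Variable F : fieldType.
Implicit Types (m a b t s i j k l : nat) (c : nat -> nat -> F).

(* v_i shifts weights by 2t - m, so it sends the k-th monomial of V(a) to a
   multiple of the (i + k - t)-th monomial of V(b), where 2t = m + a - b. *)
Definition band a b t c i : 'M[F]_(b.+1, a.+1) :=
  nmx b a (fun j k => if (j + t == i + k)%N then c i k else 0).

(** The weight condition on [t] already gives the [h]-equation, so equivariance reduces to two
    scalar recurrences, for [e] and [f], along the band. The tests on [j] and [k] record the edges
    of the matrices. *)
Lemma band_intertwiner m a b t c :
  (t + t + b = m + a)%N ->
  (forall i j k, (i <= m)%N -> (j <= b)%N -> (k <= a)%N -> (j.+1 + t = i + k)%N ->
     (if (j < b)%N then j.+1%:R * c i k else 0)
       - (if (0 < k)%N then k%:R * c i k.-1 else 0)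
     = if i == 0%N then 0 else (m - i + 1)%:R * c i.-1 k) ->
  (forall i j k, (i <= m)%N -> (j <= b)%N -> (k <= a)%N -> (j + t = i.+1 + k)%N ->
     (if (0 < j)%N then (b%:R - j.-1%:R) * c i k else 0)
       - (if (k < a)%N then (a%:R - k%:R) * c i k.+1 else 0)
     = (i + 1)%:R * (if (i < m)%N then c i.+1 k else 0)) ->
  intertwiner m (band a b t c).
Proof.
move=> wt relE relF i lei; split.
- rewrite /band mul_slH_nmx mul_nmx_slH nmxB nmxZ; apply: eq_nmx => j k _ _.
  case: eqP => [eqjk|_]; last by rewrite !mulr0 subr0.
  rewrite -mulrBl; congr (_ * _).
  have -> : b%:R = m%:R + a%:R + (2 * j)%:R - ((2 * k)%:R + (2 * i)%:R) :> F.
    by apply/eqP; rewrite eq_sym subr_eq -!natrD; apply/eqP; congr _%:R; lia.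
  by ring.
- rewrite /band mul_slE_nmx mul_nmx_slE nmxB.
  have -> : (if i == 0%N then 0 else (m - i + 1)%:R *: band a b t c i.-1) =
    nmx b a (fun j k => if (j.+1 + t == i + k)%N then
       (if i == 0%N then 0 else (m - i + 1)%:R * c i.-1 k) else 0).
    case: eqP => [_|/eqP i0].
      by rewrite -[LHS]nmx0; apply: eq_nmx => j k _ _; rewrite if_same.
    rewrite /band nmxZ; apply: eq_nmx => j k _ _.
    have -> : (j + t == i.-1 + k)%N = (j.+1 + t == i + k)%N by apply/eqP/eqP; lia.
    by case: eqP; rewrite ?mulr0.
  apply: eq_nmx => j k lej lek; case: eqP => [eqjk|nejk].
    rewrite -(relE i j k) //; congr (_ - _); case: ifP => // k0.
    by rewrite ifT //; apply/eqP; lia.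
  rewrite mulr0 if_same sub0r; case: ifP => k0; last by rewrite oppr0.
  by rewrite ifF ?mulr0 ?oppr0 //; apply/eqP; lia.
- rewrite /band mul_slF_nmx mul_nmx_slF nmxB.
  have -> : (if (i < m)%N then nmx b a (fun j k =>
      if (j + t == i.+1 + k)%N then c i.+1 k else 0) else 0) =
    nmx b a (fun j k => if (j + t == i.+1 + k)%N then
       (if (i < m)%N then c i.+1 k else 0) else 0).
    case: ifP => // _.
    by rewrite -[LHS]nmx0; apply: eq_nmx => j k _ _; rewrite if_same.
  rewrite nmxZ; apply: eq_nmx => j k lej lek.
  have [eqjk|/eqP nejk] := eqVneq (j + t)%N (i.+1 + k)%N.
    rewrite -(relF i j k) //; congr (_ - _); case: ifP => // k0.
      by rewrite ifT //; apply/eqP; lia.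
    by rewrite ifT //; apply/eqP; lia.
  rewrite (_ : (j + t == i + k.+1)%N = false); last by apply/eqP; lia.
  rewrite !mulr0 if_same subr0; case: ifP => // j0.
  by rewrite ifF ?mulr0 //; apply/eqP; lia.
Qed.

(** The intermediate monomial has the forced index [j + k - t]; the inner test says that this index
    lies between 0 and [b]. *)
Lemma mul_band a b t s c c' i j :
  band b a s c' i *m band a b t c j =
  nmx a a (fun l k => if (l + (t + s) == i + j + k)%N then
    if (t <= j + k <= t + b)%N then c' i (j + k - t)%N * c j k else 0 else 0).
Proof.
apply/matrixP => l k; rewrite !mxE.
have [letjk|ltjkt] := leqP t (j + k); last first.
  rewrite if_same big1 // => p _; rewrite !mxE.
  by rewrite [X in _ * X]ifF ?mulr0 //; apply/eqP; lia.
rewrite (eq_bigr (fun p : 'I_b.+1 => if p == (j + k - t)%N :> nat then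
    if (l + (t + s) == i + j + k)%N then c' i (j + k - t)%N * c j k else 0 else 0)).
  rewrite (sum_ord_eq _ _ (fun=> _)) /=.
  have -> : (j + k - t < b.+1)%N = (j + k <= t + b)%N by lia.
  by case: ifP => _; rewrite ?if_same.
move=> p _; rewrite !mxE.
have -> : (p + t == j + k)%N = (p == j + k - t :> nat)%N by apply/eqP/eqP; lia.
have [->|_] := eqVneq (p : nat) (j + k - t)%N; last by rewrite mulr0.
have -> : (l + s == i + (j + k - t))%N = (l + (t + s) == i + j + k)%N.
  by apply/eqP/eqP; lia.
by case: eqP; rewrite ?mul0r.
Qed.

(** Both products lie on the band [l + m = i + j + k], which is the diagonal exactly when
    [i + j = m]; only scalar identities along it remain. *)
Lemma band_commutator m a b t s c c' (g : F) : (t + s = m)%N ->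
  (forall i j k l, (i <= m)%N -> (j <= m)%N -> (k <= a)%N -> (l <= a)%N ->
    (l + m = i + j + k)%N ->
    (if (t <= j + k <= t + b)%N then c' i (j + k - t)%N * c j k else 0)
    - (if (t <= i + k <= t + b)%N then c' j (i + k - t)%N * c i k else 0)
    = if (i + j == m)%N then (-1) ^+ i * ('C(m, i))%:R * g else 0) ->
  forall i j, (i <= m)%N -> (j <= m)%N ->
  band b a s c' i *m band a b t c j - band b a s c' j *m band a b t c i =
    (if (i + j == m)%N then (-1) ^+ i * ('C(m, i))%:R * g else 0)%:M.
Proof.
move=> tsm comm i j lei lej; rewrite !mul_band tsm nmxB -nmx_scalar.
apply: eq_nmx => l k lel lek; rewrite [(j + i)%N]addnC.
have [eqs|nes] := eqVneq (l + m)%N (i + j + k)%N.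
  rewrite (comm i j k l) //.
  have [ijm|_] := eqVneq (i + j)%N m; last by rewrite if_same.
  by rewrite ifT //; apply/eqP; lia.
rewrite subrr; case: eqP => // eqlk.
by case: eqP => // ijm; move/eqP: nes; lia.
Qed.

(** Multiplication by the form [v_i = 'C(m, i) x^(m-i) y^i]. *)
Lemma mult_intertwiner m a :
  intertwiner m (band a (a + m) 0 (fun i k => 'C(m, i)%:R)).
Proof.
apply: band_intertwiner => [|i j k lei lej lek eqjk|i j k lei lej lek eqjk]; first by lia.
  rewrite addn0 in eqjk; rewrite ifT; last by lia.
  have -> : (if (0 < k)%N then k%:R * 'C(m, i)%:R else 0) = k%:R * 'C(m, i)%:R :> F.
    by case: (k) => //=; rewrite mul0r.
  rewrite eqjk -mulrBl natrD addrK; case: eqP => [->|/eqP i0]; first by rewrite mul0r.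
  rewrite -!natrM; congr _%:R.
  by have := mul_bin_left m i.-1; rewrite prednK ?lt0n // => ->; congr (_ * _)%N; lia.
rewrite addn0 in eqjk; rewrite ifT; last by lia.
have -> : (if (k < a)%N then (a%:R - k%:R) * 'C(m, i)%:R else 0) =
    (a%:R - k%:R) * 'C(m, i)%:R :> F.
  by case: ltnP => // leak; rewrite (_ : k = a) ?subrr ?mul0r //; lia.
have -> : (if (i < m)%N then 'C(m, i.+1)%:R else 0) = 'C(m, i.+1)%:R :> F.
  by case: ltnP => // ?; rewrite bin_small.
rewrite -natrM addn1 mul_bin_left natrM natrB // eqjk /= !natrD; ring.
Qed.

(* v_i acts on V(a + m) as a constant-coefficient differential operator. *)
Lemma contraction_intertwiner m a :
  intertwiner m (band (a + m) a m
    (fun i k => (-1) ^+ i * 'C(k, m - i)%:R * 'C(a + m - k, i)%:R)).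
Proof.
(* The coefficient comes from [v_i] with [x], [y] replaced by [d/dy], [-d/dx], applied to
   [x^(a+m-k) y^k] and divided by [m!]. *)
apply: band_intertwiner => [|i j k lei lej lek eqjk|i j k lei lej lek eqjk]; first by lia.
  have k0 : (0 < k)%N by lia.
  set A := 'C(k, m - i); set n := (a + m - k)%N.
  (* At the edge [j = a] one has [n = i - 1], so the omitted term vanishes by itself. *)
  have -> : (if (j < a)%N then j.+1%:R * ((-1) ^+ i * A%:R * 'C(n, i)%:R) else 0) =
      j.+1%:R * ((-1) ^+ i * A%:R * 'C(n, i)%:R) :> F.
    by case: ltnP => // leaj; rewrite [X in _ * X%:R]bin_small ?mulr0 //; lia.
  rewrite k0 (_ : a + m - k.-1 = n.+1)%N; last by lia.
  have H1 : (k * 'C(k.-1, m - i) = j.+1 * A)%N.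
    by rewrite mul_bin_down; congr (_ * _)%N; lia.
  have {}H1 : k%:R * 'C(k.-1, m - i)%:R = j.+1%:R * A%:R :> F by rewrite -!natrM H1.
  have H2 : (j.+1 * A = (m - i).+1 * 'C(k, (m - i).+1))%N.
    by rewrite -mul_bin_diag mul_bin_down; congr (_ * _)%N; lia.
  have {}H2 : j.+1%:R * A%:R = (m - i).+1%:R * 'C(k, (m - i).+1)%:R :> F.
    by rewrite -!natrM H2.
  rewrite (_ : k%:R * _ =
    (-1) ^+ i * 'C(n.+1, i)%:R * (k%:R * 'C(k.-1, m - i)%:R)); last by ring.
  (* [i = 0] is apart because [e v_0 = 0]; otherwise Pascal's rule on ['C(n.+1, i.+1)] leaves only
     the ['C(n, i)] part after subtraction. *)
  rewrite H1; case: i lei eqjk @A H1 H2 => [|i] lei eqjk A H1 H2 /=.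
    by rewrite !bin0; ring.
  rewrite binS natrD exprS addn1 (_ : m - i = (m - i.+1).+1)%N; last by lia.
  rewrite (_ : j.+1%:R * (_ * _ * _) = - (-1) ^+ i * 'C(n, i.+1)%:R * (j.+1%:R * A%:R)).
    by rewrite H2; ring.
  by ring.
have ltk : (k < a + m)%N by lia.
rewrite ltk; set n := (a + m - k)%N.
have -> : (a + m - k.+1 = n.-1)%N by lia.
(* At the edge [j = 0] one has [k = m - i - 1], so ['C(k, m - i)] vanishes. *)
have -> : (if (0 < j)%N then (a%:R - j.-1%:R) * ((-1) ^+ i * 'C(k, m - i)%:R * 'C(n, i)%:R)
    else 0) = (-1) ^+ i * 'C(k, m - i)%:R * ((n - i)%N%:R * 'C(n, i)%:R) :> F.
  case: ltnP => j0; last by rewrite ['C(k, m - i)]bin_small ?mulr0 ?mul0r //; lia.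
  have -> : a%:R - j.-1%:R = (n - i)%N%:R :> F by rewrite -natrB; [congr _%:R|]; lia.
  by ring.
have -> : (a + m)%:R - k%:R = n%:R :> F by rewrite -natrB // ltnW.
rewrite (_ : n%:R * _ =
    (-1) ^+ i * 'C(k.+1, m - i)%:R * (n%:R * 'C(n.-1, i)%:R)); last by ring.
rewrite -!natrM mul_bin_down -mul_bin_left !natrM; case: ltnP => ltim.
  rewrite (_ : m - i = (m - i.+1).+1)%N; last by lia.
  by rewrite binS !natrD exprS; ring.
by rewrite (_ : m - i = 0)%N ?bin0; [ring | lia].
Qed.

End Bands.

(** * The explicit transvectants and their commutators *)

Section Families.
Variable F : fieldType.
Implicit Types (m a b i j k l : nat).

(** Used with [i + j = m] odd, where it turns the difference of the two products in the commutator
    into a sum. *)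
Lemma signr_complement i j : odd (i + j) -> (-1) ^+ j = - (-1) ^+ i :> F.
Proof.
by rewrite oddD -signr_odd -[in RHS]signr_odd; case: odd; case: odd => //= _;
  rewrite ?expr0 ?expr1 ?opprK.
Qed.

Lemma signr_same i j : ~~ odd (i + j) -> (-1) ^+ j = (-1) ^+ i :> F.
Proof.
by rewrite oddD -signr_odd -[in RHS]signr_odd; case: odd; case: odd.
Qed.

(** On the band [m - i = j + k - l], so symmetry of binomials rewrites the product coefficients in
    terms of [l]. What is left is one binomial identity, supplied separately for each family. *)
Lemma mult_contraction_commutator m a (g : F) :
  (forall i j k l, (i <= m)%N -> (j <= m)%N -> (k <= a)%N -> (l <= a)%N ->
    (l + m = i + j + k)%N ->
    (-1) ^+ i * ('C(j + k, l) * 'C(a - l + i, i) * 'C(m, j))%:R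
    - (-1) ^+ j * ('C(i + k, l) * 'C(a - l + j, j) * 'C(m, i))%:R
    = if (i + j == m)%N then (-1) ^+ i * ('C(m, i))%:R * g else 0) ->
  forall i j, (i <= m)%N -> (j <= m)%N ->
  let A := band a (a + m) 0 (fun i k => 'C(m, i)%:R : F) in
  let B := band (a + m) a m
    (fun i k => (-1) ^+ i * 'C(k, m - i)%:R * 'C(a + m - k, i)%:R : F) in
  B i *m A j - B j *m A i =
    (if (i + j == m)%N then (-1) ^+ i * ('C(m, i))%:R * g else 0)%:M.
Proof.
move=> comm i j lei lej A B; apply: band_commutator => // {}i {}j k l {}lei {}lej lek lel e.
rewrite -(comm i j k l) // !ifT; try lia.
have term i' j' : (i' <= m)%N -> (j' <= m)%N -> (l + m = i' + j' + k)%N ->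
    (-1) ^+ i' * 'C(j' + k - 0, m - i')%:R * 'C(a + m - (j' + k - 0), i')%:R
      * 'C(m, j')%:R =
    (-1) ^+ i' * ('C(j' + k, l) * 'C(a - l + i', i') * 'C(m, j'))%:R :> F.
  move=> lei' lej' e'; rewrite subn0 (_ : m - i' = j' + k - l)%N; last by lia.
  rewrite bin_sub; last by lia.
  by rewrite (_ : a + m - (j' + k) = a - l + i')%N ?natrM ?mulrA //; lia.
by rewrite !term //; lia.
Qed.

(** Here [j = m - i], and both products contribute [(-1)^i 'C(m, i)], whence the constant 2. *)
Lemma mult_contraction_commutator0 m : odd m ->
  forall i j k l, (i <= m)%N -> (j <= m)%N -> (k <= 0)%N -> (l <= 0)%N ->
    (l + m = i + j + k)%N ->
    (-1) ^+ i * ('C(j + k, l) * 'C(0 - l + i, i) * 'C(m, j))%:R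
    - (-1) ^+ j * ('C(i + k, l) * 'C(0 - l + j, j) * 'C(m, i))%:R
    = if (i + j == m)%N then (-1) ^+ i * ('C(m, i))%:R * 2%:R else 0 :> F.
Proof.
move=> oddm i j k l lei lej; rewrite !leqn0 => /eqP-> /eqP-> e.
have ijm : (i + j)%N = m by lia.
rewrite ijm eqxx !bin0 !binn !mul1n (@signr_complement i j) ?ijm //.
by rewrite (_ : j = m - i)%N ?bin_sub //; [ring | lia].
Qed.

(** For [i + j = m] the two products contribute factors adding up to [(i + 1) + (m - i + 1)].
    Otherwise [i + j] is [m - 1] or [m + 1], which is even, and they cancel. *)
Lemma mult_contraction_commutator1 m : odd m ->
  forall i j k l, (i <= m)%N -> (j <= m)%N -> (k <= 1)%N -> (l <= 1)%N ->
    (l + m = i + j + k)%N ->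
    (-1) ^+ i * ('C(j + k, l) * 'C(1 - l + i, i) * 'C(m, j))%:R
    - (-1) ^+ j * ('C(i + k, l) * 'C(1 - l + j, j) * 'C(m, i))%:R
    = if (i + j == m)%N then (-1) ^+ i * ('C(m, i))%:R * m.+2%:R else 0 :> F.
Proof.
move=> oddm i j k l lei lej lek lel e.
have [l0|l1] : l = 0%N \/ l = 1%N by lia.
  rewrite l0 !bin0 !binSn !mul1n; case: eqP => [ijm|nijm].
    rewrite (@signr_complement i j) ?ijm // (_ : j = m - i)%N ?bin_sub //; last by lia.
    have -> : m.+2%:R = i.+1%:R + (m - i).+1%:R :> F by rewrite -natrD; congr _%:R; lia.
    by ring.
  have k1 : k = 1%N by lia.
  have -> : 'C(m, j) = 'C(m, i.+1).
    by rewrite -bin_sub; [congr 'C(_, _)|]; lia.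
  rewrite (_ : _ * 'C(m, i) = i.+1 * 'C(m, i.+1))%N.
    rewrite (_ : (-1) ^+ j = (-1) ^+ i) ?subrr //.
    by apply: signr_same; rewrite (_ : (i + j)%N = m.-1); [case: (m) oddm => //= ? /negPn | lia].
  by rewrite mul_bin_left; congr (_ * _)%N; lia.
rewrite l1 subnn !add0n !binn !bin1 !muln1; case: eqP => [ijm|nijm].
  have -> : k = 1%N by lia.
  rewrite (@signr_complement i j) ?ijm // (_ : j = m - i)%N ?bin_sub //; last by lia.
  have -> : m.+2%:R = (i + 1)%:R + (m - i + 1)%:R :> F by rewrite -natrD; congr _%:R; lia.
  by rewrite !natrM; ring.
have -> : k = 0%N by lia.
rewrite !addn0; have j0 : (0 < j)%N by lia.
have -> : 'C(m, i) = 'C(m, j.-1).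
  by rewrite -bin_sub; [congr 'C(_, _)|]; lia.
rewrite (_ : i * _ = j * 'C(m, j))%N.
  rewrite (_ : (-1) ^+ j = (-1) ^+ i) ?subrr //.
  by apply: signr_same; rewrite (_ : (i + j)%N = m.+1) /= ?negbK //; lia.
by rewrite -[in RHS](prednK j0) mul_bin_left; congr (_ * _)%N; lia.
Qed.

(** For [i] and [j] distinct, [l = k] and the contributions [k + 1] and [a - k + 1] add up to
    [a + 2]. *)
Lemma mult_contraction_commutator_sl2 a :
  forall i j k l, (i <= 1)%N -> (j <= 1)%N -> (k <= a)%N -> (l <= a)%N ->
    (l + 1 = i + j + k)%N ->
    (-1) ^+ i * ('C(j + k, l) * 'C(a - l + i, i) * 'C(1, j))%:R
    - (-1) ^+ j * ('C(i + k, l) * 'C(a - l + j, j) * 'C(1, i))%:R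
    = if (i + j == 1)%N then (-1) ^+ i * ('C(1, i))%:R * a.+2%:R else 0 :> F.
Proof.
move=> i j k l; case: i j => [|[|i]] // [|[|j]] //= _ _ lek lel e.
- by rewrite subrr.
- have -> : l = k by lia.
  rewrite ?add1n ?add0n ?addn0 ?addn1 !bin0 !bin1 !binn !binSn !muln1 !mul1n.
  have -> : a.+2%:R = k.+1%:R + (a - k).+1%:R :> F by rewrite -natrD; congr _%:R; lia.
  by ring.
- have -> : l = k by lia.
  rewrite ?add1n ?add0n ?addn0 ?addn1 !bin0 !bin1 !binn !binSn !muln1 !mul1n.
  have -> : a.+2%:R = k.+1%:R + (a - k).+1%:R :> F by rewrite -natrD; congr _%:R; lia.
  by ring.
- by rewrite subrr.
Qed.

(** [T0] and [T1] are the eigenvalues of [y d/dy] and [-x d/dx] on monomials of degree [a + 1]; the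
    constant is minus that degree, by Euler's identity. *)
Lemma contraction_mult_commutator_sl2 a i j : (i <= 1)%N -> (j <= 1)%N ->
  let A := band (a + 1) a 1
    (fun i k => (-1) ^+ i * 'C(k, 1 - i)%:R * 'C(a + 1 - k, i)%:R : F) in
  let B := band a (a + 1) 0 (fun i k => 'C(1, i)%:R : F) in
  B i *m A j - B j *m A i =
    (if (i + j == 1)%N then (-1) ^+ i * ('C(1, i))%:R * - a.+1%:R else 0)%:M.
Proof.
move=> lei lej A B; apply: band_commutator => // {}i {}j k l {}lei {}lej lek lel e.
have T0 : (if (1 <= 0 + k <= 1 + a)%N then 'C(1, 1)%:R *
    ((-1) ^+ 0 * 'C(k, 1 - 0)%:R * 'C(a + 1 - k, 0)%:R) else 0) = k%:R :> F.
  case: ifP => [_|]; first by rewrite subn0 !bin1 bin0; ring.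
  by case: (k) lek => // ?; lia.
have T1 : (if (1 <= 1 + k <= 1 + a)%N then 'C(1, 0)%:R *
    ((-1) ^+ 1 * 'C(k, 1 - 1)%:R * 'C(a + 1 - k, 1)%:R) else 0) =
    k%:R - a.+1%:R :> F.
  case: ifP => [_|lt]; first by rewrite subnn bin1 !bin0 natrB //; ring.
  by rewrite (_ : k = a.+1) ?subrr //; lia.
case: i j lei lej e => [|[|i]] // [|[|j]] // _ _ e; rewrite ?subrr // T0 T1 ?bin1 ?bin0 /=; ring.
Qed.

(* The factor m of v_i x and v_i y in V(m - 1) is dropped from the first band,
   the factor m! of the pairing with V(m - 1) from the second one. *)
Definition lower_coef m i k : F := if k == 0%N then 'C(m.-1, i.-1)%:R else - 'C(m.-1, i)%:R.

Lemma lower_intertwiner m : (0 < m)%N ->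
  intertwiner m (band 1 m.-1 1 (lower_coef m)).
Proof.
case: m => // n _; rewrite /lower_coef /=.
(* At [i = k = 0] the truncated [i.-1] gives [lower_coef] the value 1, but no entry uses it: the
   band would need [j + 1 = 0]. *)
apply: band_intertwiner => [|i j [|[|k]] // lei lej _ e|i j [|[|k]] // lei lej _ e] /=;
  first by lia.
- case: i lei e => [|[|i]] lei e; try lia.
  rewrite ifT ?subr0 /=; last by lia.
  rewrite -!natrM; congr _%:R; rewrite (_ : j = i); last by lia.
  by rewrite mul_bin_left; congr (_ * _)%N; lia.
- have -> : (if (j < n)%N then j.+1%:R * - 'C(n, i)%:R else 0) = - (j.+1 * 'C(n, i))%:R :> F.
    rewrite natrM mulrN; case: ltnP => // lenj.
    by rewrite bin_small ?mulr0 ?oppr0 //; lia.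
  case: i lei e => [|i] lei e; first by lia.
  rewrite /= (_ : j = i) ?mul_bin_left; last by lia.
  have -> : (n.+1 - i.+1 + 1 = n - i + 1)%N by lia.
  by rewrite natrM natrD; ring.
- have -> : i = j by lia.
  have -> : (j < n.+1)%N by lia.
  case: j lej e => [|j] lej e /=; first by ring.
  have H : (n%:R - j%:R) * 'C(n, j)%:R = j.+1%:R * 'C(n, j.+1)%:R :> F.
    by rewrite -natrB -?natrM ?mul_bin_left // ltnW.
  by rewrite H; ring.
rewrite (_ : j = i.+1) /=; last by lia.
rewrite ifT; last by lia.
have H : (n%:R - i%:R) * 'C(n, i)%:R = i.+1%:R * 'C(n, i.+1)%:R :> F.
  by rewrite -natrB -?natrM ?mul_bin_left //; lia.
by rewrite mulrN H; ring.
Qed.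

(** When a monomial of degree [m - 1] contracts [v_i], the binomial and the falling factorials
    combine to [m!], leaving only the sign. *)
Lemma raise_intertwiner m : (0 < m)%N ->
  intertwiner m (band m.-1 1 m.-1 (fun _ k => (-1) ^+ k : F)).
Proof.
case: m => // n _ /=.
apply: band_intertwiner => [|i [|[|j]] k // lei _ lek e|i [|[|j]] k // lei _ lek e] /=;
  first by lia.
- have -> : (i == 0)%N = false by lia.
  rewrite (_ : n.+1 - i + 1 = k.+1)%N; last by lia.
  by case: k lek e => [|k] lek e /=; rewrite ?exprS -?[k.+2%:R]natr1; ring.
- have -> : (i == 0)%N = false by lia.
  rewrite (_ : n.+1 - i + 1 = k)%N; last by lia.
  by case: k lek e => [|k] lek e /=; [lia | rewrite exprS; ring].
- rewrite !ifT; try lia.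
  by rewrite -natrB // (_ : n - k = i + 1)%N; [rewrite exprS; ring | lia].
have -> : (i < n.+1)%N by lia.
case: ltnP => ltkn.
  by rewrite -[n%:R - _]natrB // (_ : n - k = i)%N; [rewrite exprS natrD; ring | lia].
by rewrite (_ : i = 0)%N; [ring | lia].
Qed.

(** For [i + j = m] the two products add up to ['C(m, i)] by Pascal's rule, so [g = 1]; otherwise
    [i + j] is even and they cancel by symmetry of binomials. *)
Lemma lower_raise_commutator m i j : odd m -> (i <= m)%N -> (j <= m)%N ->
  let A := band 1 m.-1 1 (lower_coef m) in
  let B := band m.-1 1 m.-1 (fun _ k => (-1) ^+ k : F) in
  B i *m A j - B j *m A i =
    (if (i + j == m)%N then (-1) ^+ i * ('C(m, i))%:R * 1 else 0)%:M.
Proof.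
case: m => // n oddn lei lej A B.
apply: band_commutator => //= {}i {}j k l {}lei {}lej lek lel e.
have term0 j' : (j' <= n.+1)%N ->
    (if (0 < j' + 0 <= 1 + n)%N then (-1) ^+ (j' + 0 - 1) * lower_coef n.+1 j' 0 else 0)
    = (if (0 < j')%N then - (-1) ^+ j' * 'C(n, j'.-1)%:R else 0) :> F.
  by move=> lej'; rewrite addn0 add1n lej' andbT; case: j' {lej'} => //= j';
    rewrite subn1 /lower_coef /= exprS; ring.
have term1 j' : (j' <= n.+1)%N ->
    (if (0 < j' + 1 <= 1 + n)%N then (-1) ^+ (j' + 1 - 1) * lower_coef n.+1 j' 1 else 0)
    = - (-1) ^+ j' * 'C(n, j')%:R :> F.
  move=> lej'; rewrite addnK /lower_coef /=; case: ifP => lejn; first by ring.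
  by rewrite bin_small ?mulr0 //; lia.
have [k0|k1] : k = 0%N \/ k = 1%N by lia.
  rewrite k0 !term0 //; case: eqP => [ijn|nijn].
    rewrite (@signr_complement i j) ?ijn //.
    case: i j {lei lej oddn} ijn {e} => [|i] [|j] ijn /=; try lia.
    - by rewrite (_ : j = n) ?binn ?bin0; [ring | lia].
    - by rewrite (_ : i = n) ?binn; [ring | lia].
    have -> : 'C(n, j) = 'C(n, i.+1) by rewrite -bin_sub; [congr 'C(_, _)|]; lia.
    by rewrite binS natrD; ring.
  rewrite !ifT; try lia.
  have -> : 'C(n, j.-1) = 'C(n, i.-1) by rewrite -bin_sub; [congr 'C(_, _)|]; lia.
  rewrite (@signr_same i j) ?subrr // (_ : i + j = n.+2)%N ?negbK //; last by lia.
rewrite k1 !term1 //; case: eqP => [ijn|nijn].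
  rewrite (@signr_complement i j) ?ijn //.
  case: i j {lei lej oddn} ijn {e} => [|i] [|j] ijn /=; try lia.
  - have -> : j = n by lia.
    by rewrite !bin0 (bin_small (ltnSn n)); ring.
  - have -> : i = n by lia.
    by rewrite binn bin0 (bin_small (ltnSn n)); ring.
  have -> : 'C(n, j.+1) = 'C(n, i) by rewrite -bin_sub; [congr 'C(_, _)|]; lia.
  by rewrite binS natrD; ring.
have -> : 'C(n, j) = 'C(n, i) by rewrite -bin_sub; [congr 'C(_, _)|]; lia.
by rewrite (@signr_same i j) ?subrr // (_ : i + j = n)%N //; lia.
Qed.

(* The second transvectant V(3) x V(4) -> V(3) and the first transvectant
   V(3) x V(3) -> V(4). *)
Definition transvectant2_coef i k : F :=
  'C(3, i)%:R * ((3%:R - i%:R) * (2%:R - i%:R) * k%:R * (k%:R - 1)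
    - 2%:R * (3%:R - i%:R) * i%:R * (4%:R - k%:R) * k%:R
    + i%:R * (i%:R - 1) * (4%:R - k%:R) * (3%:R - k%:R)).

Definition transvectant1_coef i k : F := 'C(3, i)%:R * (k%:R - i%:R).

Let bin3 := (bin0, bin1, binn, erefl : 'C(3, 2) = 3%N).

(** The coefficient is that of [f_xx g_yy - 2 f_xy g_xy + f_yy g_xx] with [f = v_i] and
    [g = x^(4-k) y^k]; equivariance is checked index by index. *)
Lemma transvectant2_intertwiner : intertwiner 3 (band 4 3 2 transvectant2_coef).
Proof.
apply: band_intertwiner => // -[|[|[|[|?]]]] [|[|[|[|?]]]] [|[|[|[|[|?]]]]] //= _ _ _ _;
  by rewrite /transvectant2_coef !(bin3, subSS, subn0); ring.
Qed.

(** The coefficient is the Jacobian [(3 - i) k - i (3 - k)] divided by 3, times ['C(3, i)]. *)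
Lemma transvectant1_intertwiner : intertwiner 3 (band 3 4 1 transvectant1_coef).
Proof.
apply: band_intertwiner => // -[|[|[|[|?]]]] [|[|[|[|[|?]]]]] [|[|[|[|?]]]] //= _ _ _ _;
  by rewrite /transvectant1_coef !(bin3, subSS, subn0); ring.
Qed.

Lemma transvectant_commutator i j : (i <= 3)%N -> (j <= 3)%N ->
  let A := band 4 3 2 transvectant2_coef in
  let B := band 3 4 1 transvectant1_coef in
  B i *m A j - B j *m A i =
    (if (i + j == 3)%N then (-1) ^+ i * ('C(3, i))%:R * 72%:R else 0)%:M.
Proof.
(* The constant 72 can be read off on [x^4] for [(i, j) = (0, 3)]: the coefficients are [72] for
   [A 3] and [1] for [B 0], and the other product vanishes. *)
move=> lei lej A B; apply: band_commutator => // {lei lej A B}.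
move: i j => _ _ -[|[|[|[|?]]]] [|[|[|[|?]]]] [|[|[|[|[|?]]]]] l //= _ _ _ _ _;
  by rewrite /transvectant1_coef /transvectant2_coef ?(bin3, subSS, subn0) /=; ring.
Qed.

End Families.

(** * Existence in each of the listed cases *)

Theorem theorem4p1 (F : fieldType) (n a b : nat) :
  [pchar F] =i pred0 -> (1 <= n)%N ->
  ((n = 1%N /\ (b = a.+1 \/ (0 < a /\ b = a.-1)%N)) \/
   ((3 <= (2 * n).-1)%N /\
      ((a, b) = (0%N, (2 * n).-1) \/ (a, b) = (1%N, ((2 * n).-1).+1) \/
       (a, b) = (1%N, ((2 * n).-1).-1))) \/
   ((2 * n).-1 = 3%N /\ (a, b) = (4%N, 3%N))) ->
  exists (d : nat) (r : grep F (2 * n).-1 d),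
    [/\ is_g_rep r, faithful r & uniserial3 r a b a].
Proof.
move=> char0 n1; set m := (2 * n).-1.
have m0 : (0 < m)%N by rewrite /m; lia.
have oddm : odd m by rewrite /m -[n]prednK // mulnS /= mul2n odd_double.
have nat0 k : k.+1%:R != 0 :> F by rewrite natf_neq0_char0.
case=> [[n_1 [->|[a0 ->]]]|[[_ [[-> ->]|[[-> ->]|[-> ->]]]]|[m3 [-> ->]]]].
- have -> : m = 1%N by rewrite /m n_1.
  rewrite -(addn1 a).
  apply: (exists_uniserial_block_rep char0 _ (nat0 a.+1)) => //.
  + exact: mult_intertwiner.
  + exact: contraction_intertwiner.
  exact: mult_contraction_commutator (@mult_contraction_commutator_sl2 F a).
- have -> : m = 1%N by rewrite /m n_1.
  (* With [a] replaced by its predecessor, the outer blocks are V(a + 1) and the middle one V(a), so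
     contraction comes first and multiplication second. *)
  case: a a0 => // a _; rewrite /= -(addn1 a).
  apply: (exists_uniserial_block_rep char0 _ (g := - a.+1%:R)); rewrite ?oppr_eq0 //.
  + exact: contraction_intertwiner.
  + exact: mult_intertwiner.
  exact: contraction_mult_commutator_sl2.
- apply: (exists_uniserial_block_rep char0 m0 (nat0 1%N)).
  + exact: mult_intertwiner.
  + exact: contraction_intertwiner.
  exact: mult_contraction_commutator (mult_contraction_commutator0 F oddm).
- rewrite -add1n; apply: (exists_uniserial_block_rep char0 m0 (nat0 m.+1)).
  + exact: mult_intertwiner.
  + exact: contraction_intertwiner.
  exact: mult_contraction_commutator (mult_contraction_commutator1 F oddm).
- apply: (exists_uniserial_block_rep char0 m0 (oner_neq0 F)).
  + exact: lower_intertwiner.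
  + exact: raise_intertwiner.
  by move=> i j; apply: lower_raise_commutator.
rewrite m3; apply: (exists_uniserial_block_rep char0 _ (nat0 71%N)) => //.
- exact: transvectant2_intertwiner.
- exact: transvectant1_intertwiner.
exact: transvectant_commutator.
Qed.
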